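(* Let $G$ be a finite simple graph with no $K_4$-minor and with maximum degree $\Delta$. Then for every positive integer $k$ with $k\ge\frac{\Delta+3}{2}$, the graph $G$ admits an equitable $k$-coloring.
   Context: An equitable $k$-coloring of a graph $G$ is a proper vertex coloring $\alpha\colon V(G)\to\{1,\dots,k\}$ (adjacent vertices receive distinct colors) such that for every two colors $i,j\in\{1,\dots,k\}$ the sizes $|\alpha^{-1}(\{i\})|$ and $|\alpha^{-1}(\{j\})|$ differ by at most one (color classes may be empty). *)

(* Defs.v *)
From mathcomp Require Import all_boot.

Set Implicit Arguments.
Unset Strict Implicit.
Unset Printing Implicit Defensive.

(* A finite simple graph is a finType of vertices with a symmetric and
   irreflexive adjacency relation. *)
Definition simple_graph (V : finType) (e : rel V) : Prop :=
  symmetric e /\ irreflexive e.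

Definition complete_graph (n : nat) : rel 'I_n := fun i j => i != j.

Definition degree (V : finType) (e : rel V) (x : V) : nat := #|[set y | e x y]|.

(* This is 0 when there are no vertices. *)
Definition max_degree (V : finType) (e : rel V) : nat := \max_(x : V) degree e x.

Definition induced_edge (V : finType) (e : rel V) (A : {set V}) : rel V :=
  fun x y => [&& x \in A, y \in A & e x y].

(* A is nonempty and the subgraph induced by A is connected. *)
Definition connected_set (V : finType) (e : rel V) (A : {set V}) : Prop :=
  A != set0 /\ {in A &, forall x y, connect (induced_edge e A) x y}.

(* B assigns to each vertex u of h its branch set, the set of vertices of e
   contracted to u. *)
Definition minor_model (V U : finType) (e : rel V) (h : rel U)
    (B : U -> {set V}) : Prop :=
  [/\ forall u, connected_set e (B u),
      forall u v, u != v -> [disjoint B u & B v] &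
      forall u v, h u v -> exists x y, [/\ x \in B u, y \in B v & e x y]].

Definition has_minor (V U : finType) (e : rel V) (h : rel U) : Prop :=
  exists B : U -> {set V}, minor_model e h B.

Definition proper_coloring (V : finType) (e : rel V) (k : nat)
    (alpha : V -> 'I_k) : Prop :=
  forall x y, e x y -> alpha x != alpha y.

Definition color_class (V : finType) (k : nat) (alpha : V -> 'I_k) (i : 'I_k) :
    {set V} :=
  [set x | alpha x == i].

(* Since i and j range over all ordered pairs, the one-sided bound says that
   the two sizes differ by at most one. *)
Definition equitable_coloring (V : finType) (e : rel V) (k : nat)
    (alpha : V -> 'I_k) : Prop :=
  proper_coloring e alpha /\
  forall i j, #|color_class alpha i| <= #|color_class alpha j| + 1.

(* Main.v *)
(** By induction on the number of vertices, it suffices to delete [k] vertices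
    and to colour them, one per colour, after an equitable colouring of the
    rest. Coloured in a suitable order, a vertex that sees fewer outside
    neighbours than there are unused colours is harmless, and a [K_4]-minor-free
    graph supplies as many vertices with at most two outside neighbours as we
    like. Only the last two vertices [x1], [x2] are delicate: it is enough that
    each has at most one outside neighbour and that these two neighbours get
    different colours, which is forced by joining them with an edge in the
    remaining graph; this keeps the degrees bounded, and it creates no
    [K_4]-minor if the two neighbours are adjacent in a fixed 2-tree [T]
    containing the graph.

    Such a configuration is found by eliminating the vertices along [T]. As long
    as none occurs, every eliminated piece is a single vertex, a path on two
    vertices ending in a leaf, or a small set all of whose vertices are adjacent
    to one base vertex outside it; the bound [2k - 3] on the degrees makes this
    invariant survive the elimination of the next vertex. The only other
    possibility is a pair of nonadjacent vertices with at least [k - 1] common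
    neighbours of degree two, and these two vertices may be identified.

    That a [K_4]-minor-free graph has a vertex of degree at most two, hence lies
    in a 2-tree, follows by rotating a longest path. *)

Require Import Defs.
From mathcomp Require Import all_boot.
From mathcomp Require Import zify.

Set Implicit Arguments.
Unset Strict Implicit.
Unset Printing Implicit Defensive.

(** * Distinct representatives *)

Section DistinctRepresentatives.

Variables (V K : finType) (F : V -> {set K}).

Definition has_sdr (S : {set V}) (C : {set K}) : Prop :=
  exists2 f : V -> K, {in S &, injective f} & {in S, forall z, f z \in C :\: F z}.

Lemma has_sdr_setU1 (S : {set V}) (C : {set K}) z :
  z \notin S -> #|F z| < #|C| -> {in C, forall c, has_sdr S (C :\ c)} ->
  has_sdr (z |: S) C.
Proof.
move=> zS ltFC sdrS.
have [c]: exists c, c \in C :\: F z.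
  apply/set0Pn; rewrite -card_gt0.
  by have := cardsID (F z) C; have := subset_leq_card (subsetIr C (F z)); lia.
rewrite inE => /andP[cF cC].
have [f f_inj fC] := sdrS c cC.
exists (fun w => if w == z then c else f w).
  move=> u w; rewrite !in_setU1.
  case: eqP => [->|_] /=; case: eqP => [->|_] //= uS wS.
  - by move=> cE; have := fC w wS; rewrite -cE !inE eqxx /= andbF.
  - by move=> cE; have := fC u uS; rewrite cE !inE eqxx /= andbF.
  - exact: f_inj.
move=> w; rewrite in_setU1; case: eqP => [->|_] /=; first by rewrite inE cF.
by move=> /fC; rewrite !inE => /and3P[-> _ ->].
Qed.

Lemma has_sdr2 x y (C : {set K}) :
  x != y -> #|C| = 2 -> #|F x| <= 1 -> #|F y| <= 1 -> [disjoint F x & F y] ->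
  has_sdr [set x; y] C.
Proof.
move=> xy cC Fx Fy dF.
have [p [q [pq CE]]] : exists p q, p != q /\ C = [set p; q].
  by move/eqP/cards2P: cC => [p [q [pq ->]]]; exists p, q.
have sdrpq (f := fun z => if z == x then p else q) (g := fun z => if z == x then q else p) :
   (p \notin F x /\ q \notin F y) \/ (q \notin F x /\ p \notin F y).
  have F1 (G : {set K}) : #|G| <= 1 -> p \in G -> q \notin G.
    move=> /card_le1_eqP G1 pG; apply: contra pq => qG.
    by rewrite (G1 p q).
  have F2 : (p \in F x -> p \notin F y) by move=> h; rewrite (disjointFr dF).
  have F3 : (q \in F x -> q \notin F y) by move=> h; rewrite (disjointFr dF).
  have := F1 _ Fx; have := F1 _ Fy.
  case: (p \in F x) F2 => F2; case: (q \in F x) F3 => F3;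
  case: (p \in F y) F2 => F2; case: (q \in F y) F3 => F3 //= h1 h2;
    do ?[by left]; do ?[by right];
    by [have := h1 isT|have := h2 isT|have := F2 isT|have := F3 isT].
have aux a b : a != b -> a \in C -> b \in C -> a \notin F x -> b \notin F y -> has_sdr [set x; y] C.
  have yx : (y == x) = false by rewrite eq_sym (negPf xy).
  move=> ab aC bC ax bY; exists (fun z => if z == x then a else b).
    move=> u w; rewrite !in_set2 => /orP[]/eqP-> /orP[]/eqP->; rewrite ?eqxx ?yx // => E;
      by rewrite E eqxx in ab.
  move=> w; rewrite in_set2 => /orP[]/eqP->; rewrite ?eqxx ?yx inE.
    by rewrite ax aC.
  by rewrite bY bC.
case: sdrpq => -[h1 h2].
  by apply: (aux p q) => //; rewrite CE !inE eqxx ?orbT.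
by apply: (aux q p) => //; rewrite 1?eq_sym // CE !inE eqxx ?orbT.
Qed.

Lemma has_sdr_greedy (S : {set V}) (C : {set K}) x y h1 h2 :
  x \in S -> y \in S -> x != y -> #|S| = #|C| ->
  #|F x| <= 1 -> #|F y| <= 1 -> [disjoint F x & F y] ->
  {in S, forall z, z != x -> z != y ->
     [\/ #|F z| <= 2, z = h1 /\ #|F z| < #|C| | z = h2 /\ #|F z| < #|C|.-1]} ->
  has_sdr S C.
Proof.
move=> xS yS xy cSC Fx Fy dF FS.
have small (M : {set V}) (D : {set K}) : #|D| = #|M| + 2 -> x \notin M -> y \notin M ->
    {in M, forall z, #|F z| <= 2} -> has_sdr (M :|: [set x; y]) D.
  elim: {M}_.+1 {-2}M (ltnSn #|M|) D => // m IH M ltM D cD xM yM FM.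
  have [M0|[z zM]] := set_0Vmem M.
    rewrite M0 set0U; apply: has_sdr2 => //.
    by rewrite cD M0 cards0.
  have cM := cardsD1 z M; rewrite zM in cM.
  rewrite -(setD1K zM) -setUA; apply: has_sdr_setU1.
  - rewrite !inE eqxx /= negb_or.
    by apply/andP; split; [apply: contra xM|apply: contra yM] => /eqP<-.
  - by have := FM z zM; rewrite cD; lia.
  move=> c cD'; apply: IH.
  - by lia.
  - by have := cardsD1 c D; rewrite cD'; lia.
  - by rewrite inE (negPf xM) andbF.
  - by rewrite inE (negPf yM) andbF.
  - by move=> w; rewrite inE => /andP[_]; apply: FM.
pose M0 := S :\: [set x; y]; pose M1 := M0 :\ h1; pose M2 := M1 :\ h2.
have SE : S = M0 :|: [set x; y].
  rewrite setUC -[LHS](setID S [set x; y]); congr (_ :|: _).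
  by apply/setIidPr; apply/subsetP=> w; rewrite !inE => /orP[]/eqP->.
have cS : #|S| = #|M0| + 2.
  have := cardsID [set x; y] S; rewrite (_ : S :&: _ = [set x; y]) ?cards2 ?xy -/M0; first by lia.
  by apply/setIidPr; apply/subsetP=> w; rewrite !inE => /orP[]/eqP->.
have inM0 z : (z \in M0) = [&& z != x, z != y & z \in S].
  by rewrite !inE negb_or -andbA.
have sdr2 (D : {set K}) : #|D| = #|M2| + 2 -> has_sdr (M2 :|: [set x; y]) D.
  move=> cD; apply: small => //; rewrite ?[_ \in M2]in_setD1 ?[_ \in M1]in_setD1 ?inM0 ?eqxx ?andbF //.
  move=> z; rewrite 2!in_setD1 inM0 => /and5P[z2 z1 zx zy zS].
  case: (FS z zS zx zy) => // -[zE]; first by rewrite zE eqxx in z1.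
  by rewrite zE eqxx in z2.
have sdr1 (D : {set K}) : #|D| = #|M1| + 2 -> #|C| <= #|D|.+1 -> has_sdr (M1 :|: [set x; y]) D.
  move=> cD CD; have [h2M|h2M] := boolP (h2 \in M1); last first.
    have E : M2 = M1 by apply/setP=> w; rewrite in_setD1; case: eqP => // ->; rewrite (negPf h2M).
    by rewrite -E; apply: sdr2; rewrite E.
  have cM := cardsD1 h2 M1; rewrite h2M -/M2 in cM.
  move: (h2M); rewrite in_setD1 inM0 => /and4P[h21 h2x h2y h2S].
  rewrite -(setD1K h2M) -setUA; apply: has_sdr_setU1.
  - by rewrite !inE eqxx (negPf h2x) (negPf h2y).
  - case: (FS h2 h2S h2x h2y) => [| [E _]|[_]]; [by lia|by rewrite E eqxx in h21|by lia].
  move=> c cD'; apply: sdr2.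
  by have := cardsD1 c D; rewrite cD'; lia.
rewrite SE; have [h1M|h1M] := boolP (h1 \in M0); last first.
  have E : M1 = M0 by apply/setP=> w; rewrite in_setD1; case: eqP => // ->; rewrite (negPf h1M).
  by rewrite -E; apply: sdr1; rewrite ?E //; lia.
have cM := cardsD1 h1 M0; rewrite h1M -/M1 in cM.
move: (h1M); rewrite inM0 => /and3P[h1x h1y h1S].
rewrite -(setD1K h1M) -setUA; apply: has_sdr_setU1.
- by rewrite !inE eqxx (negPf h1x) (negPf h1y).
- case: (FS h1 h1S h1x h1y) => [|[_]//|[_]]; by lia.
move=> c cC; apply: sdr1; have := cardsD1 c C; rewrite cC; lia.
Qed.

End DistinctRepresentatives.

(** * Extending equitable colourings *)

Lemma exists_injection (V K : finType) (S : {set V}) (C : {set K}) (c0 : K) :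
  #|S| <= #|C| ->
  exists2 f : V -> K, {in S &, injective f} & {in S, forall z, f z \in C}.
Proof.
move=> leSC; exists (fun z => nth c0 (enum C) (index z (enum S))).
  move=> u w uS wS /eqP; rewrite nth_uniq -?cardE ?enum_uniq //.
  - by move=> /eqP; apply: (index_inj u); rewrite mem_enum.
  - by apply: leq_trans leSC; rewrite cardE index_mem mem_enum.
  - by apply: leq_trans leSC; rewrite cardE index_mem mem_enum.
move=> z zS; have: nth c0 (enum C) (index z (enum S)) \in enum C.
  by apply: mem_nth; rewrite -cardE; apply: leq_trans leSC; rewrite cardE index_mem mem_enum.
by rewrite mem_enum.
Qed.

Section Graphs.

Variable V : finType.
Implicit Types (g T : rel V) (rk : V -> nat) (A S : {set V}).

Definition nbr g x := [set y | g x y].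

Definition upper T rk x := [set z | T x z & rk x < rk z].

Definition elimination T rk : Prop :=
  [/\ symmetric T, injective rk, forall x, #|upper T rk x| <= 2 &
      forall x, {in upper T rk x &, forall y z, y != z -> T y z}].

Definition partial_2tree A g T rk : Prop :=
  [/\ simple_graph g, forall x y, g x y -> x \in A, subrel g T & elimination T rk].

Definition equitable_on A g k (alpha : V -> 'I_k) : Prop :=
  (forall x y, g x y -> alpha x != alpha y) /\
  (forall i j, #|[set x in A | alpha x == i]| <= #|[set x in A | alpha x == j]| + 1).

Lemma equitable_on_small A g k : 0 < k -> #|A| <= k -> simple_graph g ->
  (forall x y, g x y -> x \in A) -> exists alpha : V -> 'I_k, equitable_on A g alpha.
Proof.
move=> k0 Ak [gs gi] gA.
have [|f f_inj _] := @exists_injection V 'I_k A [set: 'I_k] (Ordinal k0).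
  by rewrite cardsT card_ord.
exists f; split=> [x y gxy|i j].
  apply: contraTneq gxy => fxy; apply/negP => gxy.
  have xA := gA _ _ gxy; have yA : y \in A by apply: (gA y x); rewrite gs.
  by move: gxy; rewrite (f_inj x y xA yA fxy) gi.
rewrite addn1; apply: (@leq_trans 1) => //.
apply/card_le1_eqP => x y; rewrite !inE => /andP[xA /eqP fx] /andP[yA /eqP fy].
by apply: f_inj => //; rewrite fx.
Qed.

Lemma equitable_extend A g k S (alpha : V -> 'I_k) (f : V -> 'I_k) :
  symmetric g -> irreflexive g -> S \subset A -> #|S| = k ->
  (forall x y, x \notin S -> y \notin S -> g x y -> alpha x != alpha y) ->
  (forall i j, #|[set x in A :\: S | alpha x == i]|
      <= #|[set x in A :\: S | alpha x == j]| + 1) ->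
  {in S &, injective f} ->
  {in S, forall z, f z \notin alpha @: (nbr g z :\: S)} ->
  exists beta : V -> 'I_k, equitable_on A g beta.
Proof.
move=> gs gi SA cS alphaP alphaE f_inj fP.
exists (fun x => if x \in S then f x else alpha x); split.
  move=> x y gxy.
  have mix u w : u \in S -> w \notin S -> g u w -> f u != alpha w.
    move=> uS wS guw; apply: contra (fP u uS) => /eqP->.
    by apply: imset_f; rewrite !inE wS.
  case: (boolP (x \in S)) => xS; case: (boolP (y \in S)) => yS.
  - by apply: contraTneq gxy => /f_inj -> //; rewrite gi.
  - exact: mix.
  - by rewrite eq_sym; apply: mix => //; rewrite gs.
  - exact: alphaP.
have fS : f @: S = [set: 'I_k].
  by apply/eqP; rewrite eqEcard subsetT cardsT card_ord card_in_imset ?cS ?leqnn.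
have cls i : #|[set x in A | (if x \in S then f x else alpha x) == i]| =
    #|[set x in A :\: S | alpha x == i]|.+1.
  have /imsetP[s sS ->]: i \in f @: S by rewrite fS inE.
  rewrite (_ : [set x in A | _] = s |: [set x in A :\: S | alpha x == f s]).
    by rewrite cardsU1 !inE sS.
  apply/setP=> x; rewrite !inE; have [->|xs] /= := eqVneq x s.
    by rewrite (subsetP SA) // sS eqxx.
  have [xS|xS] //= := boolP (x \in S).
  by rewrite andbC; apply: contra_neqF xs => /andP[/eqP/f_inj->].
by move=> i j; rewrite !cls addSn ltnS.
Qed.

Lemma lowest_subset rk (W : {set V}) m : injective rk -> m <= #|W| ->
  exists Z : {set V}, [/\ Z \subset W, #|Z| = m &
    forall z w, z \in Z -> w \in W -> rk w < rk z -> w \in Z].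
Proof.
move=> rk_inj; elim: m => [|m IH] leW.
  by exists set0; rewrite sub0set cards0; split=> // z w; rewrite inE.
have [Z [ZW cZ Zlow]] := IH (ltnW leW).
have [w0 w0P]: exists w, w \in W :\: Z.
  by apply/set0Pn; rewrite -card_gt0; have := cardsD W Z; rewrite (setIidPr ZW); lia.
pose w := [arg min_(w < w0 in W :\: Z) rk w].
have [wW wZ wmin] : [/\ w \in W, w \notin Z & forall u, u \in W -> u \notin Z -> rk w <= rk u].
  rewrite /w; case: arg_minnP => // u; rewrite inE => /andP[uZ uW] umin; split=> //.
  by move=> x xW xZ; apply: umin; rewrite inE xZ.
exists (w |: Z); split.
- by rewrite subUset sub1set wW.
- by rewrite cardsU1 wZ cZ.
move=> z u; rewrite !in_setU1 => /orP[/eqP->|zZ] uW ltu.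
  by apply/orP; right; apply: contraTT ltu => uZ; rewrite -leqNgt wmin.
by apply/orP; right; apply: Zlow ltu.
Qed.

Lemma card_upper g T rk z : subrel g T -> elimination T rk ->
  #|[set w in nbr g z | rk z < rk w]| <= 2.
Proof.
move=> gT [_ _ up2 _]; apply: leq_trans (up2 z); apply/subset_leq_card/subsetP => w.
by rewrite !inE => /andP[/gT-> ->].
Qed.

(* The colours of [S] are chosen in the order [h1], [h2], other vertices, [x1]
   and [x2]; the vertices [h1] and [h2] are ignored when they are not in [S] or
   equal to [x1] or [x2]. *)
Definition reducible A g T k : Prop := exists S x1 x2 h1 h2,
  [/\ S \subset A, #|S| <= k, [/\ x1 \in S, x2 \in S & x1 != x2],
    [/\ #|nbr g x1 :\: S| <= 1, #|nbr g x2 :\: S| <= 1 &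
     {in nbr g x1 :\: S & nbr g x2 :\: S, forall u w, u != w /\ T u w}] &
    {in S, forall z, z != x1 -> z != x2 ->
      [\/ #|nbr g z :\: S| <= 2, z = h1 /\ #|nbr g z :\: S| < k |
          z = h2 /\ #|nbr g z :\: S| < k.-1]}].

Definition restrict A g : rel V := fun x y => [&& x \in A, y \in A & g x y].

Definition add_edge g u w : rel V := fun x y =>
  [|| g x y, (x == u) && (y == w) | (x == w) && (y == u)].

Definition max_deg_le g d := forall x, #|nbr g x| <= d.

Lemma reducible_extend A g T rk k d :
  partial_2tree A g T rk -> max_deg_le g d -> k <= #|A| ->
  (forall A' g', #|A'| < #|A| -> partial_2tree A' g' T rk -> max_deg_le g' d ->
     exists alpha : V -> 'I_k, equitable_on A' g' alpha) ->
  reducible A g T k -> exists alpha : V -> 'I_k, equitable_on A g alpha.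
Proof.
move=> [[gs gi] gA gT Tel] dg kA IH [S0 [x1 [x2 [h1 [h2 [S0A cS0 [x1S0 x2S0 x12]]]]]]].
move=> [o1 o2 o12] oS0.
have [Ts rk_inj _ _] := Tel.
have [|F [FA cF Flow]] := @lowest_subset rk (A :\: S0) (k - #|S0|) rk_inj.
  by rewrite cardsD (setIidPr S0A); lia.
pose S := S0 :|: F.
have S0S : S0 \subset S := subsetUl _ _.
have dS0F : [disjoint S0 & F].
  rewrite disjoint_sym disjoints_subset; apply: subset_trans FA _.
  by apply/subsetP => z; rewrite !inE => /andP[].
have cS : #|S| = k by rewrite cardsU disjoint_setI0 // cards0 cF; lia.
have SA : S \subset A.
  by rewrite subUset S0A; apply: subset_trans FA (subsetDl _ _).
have outS z : nbr g z :\: S \subset nbr g z :\: S0 by apply: setDS.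
have outF z : z \in F -> #|nbr g z :\: S| <= 2.
  move=> zF; apply: leq_trans (card_upper z gT Tel).
  apply/subset_leq_card/subsetP => w; rewrite !inE negb_or => /andP[/andP[wS0 wF] gzw].
  rewrite gzw ltn_neqAle /=; apply/andP; split.
    by apply: contraNneq wF => /rk_inj <-.
  rewrite leqNgt; apply: contra wF; apply: Flow zF _; rewrite inE wS0 (gA w z) //.
  by rewrite gs.
have cpos : 0 < k by rewrite -cS card_gt0; apply/set0Pn; exists x1; rewrite (subsetP S0S).
pose g0 := restrict (A :\: S) g.
have [g' [P' d' gg' o12']] : exists g', [/\ partial_2tree (A :\: S) g' T rk, max_deg_le g' d,
    subrel g0 g' & {in nbr g x1 :\: S & nbr g x2 :\: S, forall u w, g' u w}].
  have P0 : partial_2tree (A :\: S) g0 T rk.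
    split=> //; last by move=> x y /and3P[_ _ /gT].
      split=> [x y|x]; last by rewrite /g0 /restrict gi !andbF.
      by rewrite /g0 /restrict gs; case: (x \in _); case: (y \in _).
    by move=> x y /and3P[].
  have d0 : max_deg_le g0 d.
    move=> x; apply: leq_trans (dg x); apply/subset_leq_card/subsetP => w.
    by rewrite !inE => /and3P[].
  have [O1|[u uO]] := set_0Vmem (nbr g x1 :\: S).
    by exists g0; split=> // u w; rewrite O1 inE.
  have [O2|[w wO]] := set_0Vmem (nbr g x2 :\: S).
    by exists g0; split=> // u' w _; rewrite O2 inE.
  have [uw Tuw] := o12 u w (subsetP (outS x1) u uO) (subsetP (outS x2) w wO).
  have uniqO x v v' : #|nbr g x :\: S0| <= 1 -> v \in nbr g x :\: S -> v' \in nbr g x :\: S -> v' = v.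
    move=> /card_le1_eqP h /(subsetP (outS x)) vO /(subsetP (outS x)) v'O; exact: h.
  have inAS v x : v \in nbr g x :\: S -> v \in A :\: S.
    rewrite in_setD => /andP[vS]; rewrite !inE gs => /gA ->.
    by move: vS; rewrite !inE => ->.
  exists (add_edge g0 u w); split.
  - have [[g0s g0i] g0A g0T _] := P0; split=> //.
    + split=> [x y|x]; rewrite /add_edge.
        rewrite g0s; by rewrite [(x == u) && _]andbC [(x == w) && _]andbC [X in _ || X]orbC.
      by rewrite g0i; case: (eqVneq x u) => [->|_]; rewrite ?eqxx ?(negPf uw) ?andbF.
    + move=> x y /or3P[/g0A//|/andP[/eqP-> _]|/andP[/eqP-> _]]; [exact: inAS uO|exact: inAS wO].
    + move=> x y /or3P[/g0T//|/andP[/eqP-> /eqP->]|/andP[/eqP-> /eqP->]] //.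
      by rewrite Ts.
  - have addd v x v' : v \in nbr g x :\: S -> x \in S ->
       #|v' |: nbr g0 v| <= d.
      move=> vO xS; apply: leq_trans (dg v).
      have xv : x \in nbr g v by move: vO; rewrite !inE gs => /andP[].
      have := cardsD1 x (nbr g v); rewrite xv cardsU1.
      have : #|nbr g0 v| <= #|nbr g v :\ x|.
        apply/subset_leq_card/subsetP => z; rewrite inE => /and3P[_ zAS gvz].
        rewrite in_setD1 inE gvz andbT; move: zAS; rewrite in_setD => /andP[zS _].
        by apply: contraNneq zS => ->.
      by move=> le_g0 ->; apply: leq_add; rewrite ?leq_b1.
    move=> x; have [->|xu] := eqVneq x u.
      apply: leq_trans (addd u x1 w uO _); last exact: (subsetP S0S).
      apply/subset_leq_card/subsetP => z; rewrite !inE /add_edge eqxx (negPf uw) /= orbF.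
      by rewrite orbC.
    have [->|xw] := eqVneq x w.
      apply: leq_trans (addd w x2 u wO _); last exact: (subsetP S0S).
      apply/subset_leq_card/subsetP => z; rewrite !inE /add_edge eqxx eq_sym (negPf uw) /=.
      by rewrite orbC.
    apply: leq_trans (d0 x); apply/subset_leq_card/subsetP => z; rewrite !inE /add_edge.
    by rewrite (negPf xu) (negPf xw) /= orbF.
  - by move=> x y; rewrite /add_edge => ->.
  - move=> u' w' u'O w'O; rewrite (uniqO _ _ _ o1 uO u'O) (uniqO _ _ _ o2 wO w'O).
    by rewrite /add_edge !eqxx orbT.
have [|alpha [aP aE]] := IH (A :\: S) g' _ P' d'.
  by rewrite cardsD (setIidPr SA) cS; lia.
pose Fc z := alpha @: (nbr g z :\: S).
have leF z : #|Fc z| <= #|nbr g z :\: S0|.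
  by apply: leq_trans (leq_imset_card _ _) _; apply: subset_leq_card.
have [||||||||f f_inj fP] := @has_sdr_greedy V 'I_k Fc S [set: 'I_k] x1 x2 h1 h2.
- exact: (subsetP S0S).
- exact: (subsetP S0S).
- by [].
- by rewrite cardsT card_ord.
- exact: leq_trans (leF _) o1.
- exact: leq_trans (leF _) o2.
- rewrite -setI_eq0; apply/eqP/setP => c; rewrite !inE; apply/andP.
  move=> -[/imsetP[u uO ->] /imsetP[w wO /eqP]]; apply/negP.
  exact/aP/o12'.
- rewrite cardsT card_ord => z; rewrite in_setU => /orP[zS0 z1 z2|zF _ _]; last first.
    by constructor 1; apply: leq_trans (outF z zF); apply: leq_imset_card.
  case: (oS0 z zS0 z1 z2) => [le2|[zE lek]|[zE lek]].
  + by constructor 1; apply: leq_trans le2.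
  + by constructor 2; split=> //; apply: leq_ltn_trans lek.
  + by constructor 3; split=> //; apply: leq_ltn_trans lek.
apply: (@equitable_extend A g k S alpha f) => //.
  move=> x y xS yS gxy; apply: aP; apply: gg'.
  have yA : y \in A by apply: (gA y x); rewrite gs.
  by rewrite /g0 /restrict !in_setD (negPf xS) (negPf yS) yA (gA x y).
by move=> z /fP; rewrite in_setD => /andP[].
Qed.

End Graphs.

(** * Identifying two vertices *)

Section Contraction.

Variable V : finType.
Implicit Types (g T : rel V) (rk : V -> nat) (A L : {set V}).

Definition merge r y q : rel V := fun a b =>
  [&& a != y, b != y & [|| r a b, [&& a == q, b != q & r y b] |
                           [&& b == q, a != q & r y a]]].

Lemma merge_sym r y q : symmetric r -> symmetric (merge r y q).
Proof.
move=> rs a b; rewrite /merge (rs b a).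
case: (a != y); case: (b != y); rewrite //=.
by rewrite [X in _ || X]orbC.
Qed.

Lemma merge_elimination T rk y q : elimination T rk -> T y q -> rk y < rk q ->
  elimination (merge T y q) rk.
Proof.
move=> [Ts rk_inj up2 upT] Tyq lt_yq.
have qy : q \in upper T rk y by rewrite inE Tyq.
have key x : x != y -> (upper (merge T y q) rk x \subset upper T rk x) \/
    [/\ x != q, y \in upper T rk x & upper (merge T y q) rk x \subset q |: (upper T rk x :\ y)].
  move=> xy; have [xq|xq] := eqVneq x q.
    left; apply/subsetP => z; rewrite xq !inE => /andP[/and3P[_ zy]]; rewrite eqxx andbF orbF /=.
    move=> /orP[-> ->//|/andP[zq Tyz] lt_qz]; rewrite lt_qz andbT.
    by apply: (upT y) => //; rewrite 1?eq_sym // inE Tyz (ltn_trans lt_yq).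
  have [yx|yx] := boolP (y \in upper T rk x).
    right; split=> //; apply/subsetP => z; rewrite !inE => /andP[/and3P[_ zy]].
    rewrite (negPf xq) zy /= => /orP[-> ->|/andP[-> _]] //.
    by rewrite orbT.
  left; apply/subsetP => z; rewrite !inE => /andP[/and3P[_ zy]].
  rewrite (negPf xq) /= => /orP[-> ->//|/andP[/eqP-> Tyx] lt_xq]; rewrite lt_xq andbT.
  apply: (upT y) => //; rewrite inE Tyx /= ltn_neqAle leqNgt.
  move: yx; rewrite inE Ts Tyx /= => ->; rewrite andbT.
  by apply: contraNneq xy => /rk_inj ->.
have upy : upper (merge T y q) rk y = set0.
  by apply/setP => z; rewrite !inE /merge eqxx.
split=> // [|x|x].
- exact: merge_sym.
- have [->|xy] := eqVneq x y; first by rewrite upy cards0.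
  case: (key x xy) => [/subset_leq_card h|[_ yx /subset_leq_card h]].
    exact: leq_trans h (up2 x).
  apply: leq_trans h _; apply: leq_trans (up2 x); rewrite cardsU1 (cardsD1 y (upper T rk x)) yx.
  by case: (_ \notin _).
move=> a b; have [->|xy] := eqVneq x y; first by rewrite upy inE.
move=> aU bU ab.
have ay : a != y by move: aU; rewrite !inE => /andP[/and3P[]].
have bY : b != y by move: bU; rewrite !inE => /andP[/and3P[]].
rewrite /merge ay bY /=.
case: (key x xy) => [/subsetP h|[xq yx /subsetP h]].
  by rewrite (upT x) // h.
move: (h a aU) (h b bU); rewrite !in_setU1 !in_setD1 ay bY /=.
have [aq|_] /= := eqVneq a q; have [bq|_] /= := eqVneq b q => ax bx.
- by move: ab; rewrite aq bq eqxx.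
- by rewrite (upT x y b) ?orbT // eq_sym.
- by rewrite (upT x y a) ?orbT // eq_sym.
- by rewrite (upT x).
Qed.

Definition twin_reducible g T rk k : Prop := exists y q (L : {set V}),
  [/\ ~~ g y q, T y q, rk y < rk q, k.-1 <= #|L| & {in L, forall l, nbr g l = [set y; q]}].

(* After colouring the graph in which [y] and [q] are identified, [y] takes the
   colour of [q], which leaves exactly [k.-1] colours to [k.-1] of their common
   neighbours. *)
Lemma twin_reducible_extend A g T rk k d : 1 < k -> d <= 2 * k.-1 ->
  partial_2tree A g T rk -> max_deg_le g d ->
  (forall A' g' T', #|A'| < #|A| -> partial_2tree A' g' T' rk -> max_deg_le g' d ->
     exists alpha : V -> 'I_k, equitable_on A' g' alpha) ->
  twin_reducible g T rk k -> exists alpha : V -> 'I_k, equitable_on A g alpha.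
Proof.
move=> k1 dk [[gs gi] gA gT Tel] dg IH [y [q [L0 [gyq Tyq lt_yq kL0 nL0]]]].
have [Ts rk_inj _ _] := Tel.
have [L [LL0 cL _]] := lowest_subset rk_inj kL0.
have nL l : l \in L -> nbr g l = [set y; q] by move=> /(subsetP LL0)/nL0.
have gL l z : l \in L -> g l z = (z == y) || (z == q).
  by move=> /nL/setP/(_ z); rewrite !inE.
have qy : q != y by apply: contraTneq lt_yq => ->; rewrite ltnn.
have yL : y \notin L by apply/negP => h; have := gL y y h; rewrite gi eqxx.
have qL : q \notin L by apply/negP => h; have := gL q q h; rewrite gi eqxx orbT.
have [l0 l0L] : exists l, l \in L by apply/set0Pn; rewrite -card_gt0 cL; clear -k1; lia.
have yA : y \in A by apply: (gA y l0); rewrite gs gL // eqxx.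
have qA : q \in A by apply: (gA q l0); rewrite gs gL // eqxx orbT.
pose S := y |: L.
have SA : S \subset A.
  rewrite subUset sub1set yA; apply/subsetP => l lL; apply: (gA l y).
  by rewrite gL // eqxx.
have cS : #|S| = k by rewrite cardsU1 yL cL; clear -k1; lia.
have qS : q \in A :\: S by rewrite !inE (negPf qy) (negPf qL).
pose g' := restrict (A :\: S) (merge g y q).
have g's : symmetric g'.
  by move=> a b; rewrite /g' /restrict merge_sym //; case: (a \in _); case: (b \in _).
have dq : #|nbr g q :\: L| <= d - k.-1.
  have -> : #|nbr g q :\: L| = #|nbr g q| - #|L|.
    rewrite cardsD (setIidPr _) //; apply/subsetP => l lL.
    by rewrite inE gs gL // eqxx orbT.
  by rewrite cL leq_sub2r.
have dy : #|nbr g y :\: L| <= d - k.-1.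
  have -> : #|nbr g y :\: L| = #|nbr g y| - #|L|.
    rewrite cardsD (setIidPr _) //; apply/subsetP => l lL.
    by rewrite inE gs gL // eqxx.
  by rewrite cL leq_sub2r.
have [|||alpha [aP aE]] := IH (A :\: S) g' (merge T y q).
- by rewrite cardsD (setIidPr SA) cS; have := subset_leq_card SA; rewrite cS; clear -k1; lia.
- split; last exact: merge_elimination.
  + by split=> // x; rewrite /g' /restrict /merge gi; case: (x == q); rewrite /= ?andbF.
  + by move=> a b /and3P[].
  + move=> a b /and3P[_ _ /and3P[ay bY gab]]; rewrite /merge ay bY /=.
    case/or3P: gab => [/gT->//|/and3P[-> -> /gT->]|/and3P[-> -> /gT->]] //.
      by rewrite orbT.
    by rewrite !orbT.
- move=> x; have [->|xq] := eqVneq x q.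
    apply: (@leq_trans #|(nbr g q :\: L) :|: (nbr g y :\: L)|); last first.
      by apply: leq_trans (leq_card_setU _ _) _; move: dq dy; clear -dk; lia.
    apply/subset_leq_card/subsetP => z; rewrite !inE => /and3P[_].
    rewrite !inE negb_or => /andP[/andP[_ ->] _] /and3P[_ _].
    by rewrite eqxx andbF orbF /= => /orP[->//|/andP[_ ->]]; rewrite orbT.
  have [gyx|gyx] := boolP (g y x).
    apply: leq_trans (dg x).
    apply: (@leq_trans #|q |: (nbr g x :\ y)|).
      apply/subset_leq_card/subsetP => z; rewrite !inE => /and3P[_ _ /and3P[_ -> h]].
      by move: h; rewrite (negPf xq) /= => /orP[->|/andP[->]]; rewrite ?orbT.
    have yx : y \in nbr g x by rewrite inE gs.
    by rewrite cardsU1 (cardsD1 y (nbr g x)) yx leq_add // leq_b1.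
  apply: leq_trans (dg x); apply/subset_leq_card/subsetP => z; rewrite !inE.
  by move=> /and3P[_ _ /and3P[_ _]]; rewrite (negPf xq) (negPf gyx) /= !andbF orbF.
have [|f f_inj fC] := @exists_injection V 'I_k L [set~ alpha q] (alpha q).
  by rewrite cL cardsC1 card_ord.
have g'P a b : a \in A :\: S -> b \in A :\: S -> merge g y q a b -> g' a b.
  by rewrite /g' /restrict => -> ->.
have notS a b : a \notin S -> g a b -> a \in A :\: S by rewrite in_setD => -> /gA.
apply: (@equitable_extend V A g k S alpha (fun z => if z == y then alpha q else f z)) => //.
- move=> a b aS bS gab; apply: aP; apply: g'P.
  + exact: notS gab.
  + by apply: (notS _ a) => //; rewrite gs.
  rewrite /merge gab andbT; move: aS bS.
  by rewrite !inE !negb_or => /andP[-> _] /andP[-> _].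
- move=> a b; rewrite !in_setU1; case: eqP => [->|_]; case: eqP => [->|_] //= aL bL.
  + by move=> E; move: (fC b bL); rewrite -E !inE eqxx.
  + by move=> E; move: (fC a aL); rewrite E !inE eqxx.
  + exact: f_inj.
move=> z; rewrite in_setU1; case: eqP => [->|_] /= zL; apply/negP => /imsetP[w].
  rewrite in_setD => /andP[wS]; rewrite inE => gyw /eqP; apply/negP; apply: aP; apply: g'P => //.
    by apply: (notS _ y) => //; rewrite gs.
  rewrite /merge qy eqxx gyw; move: wS; rewrite in_setU1 negb_or => /andP[-> _] /=.
  by rewrite (_ : w != q) ?orbT //; apply: contraNneq gyq => <-.
rewrite in_setD in_setU1 => /andP[/norP[/negPf wy _]].
rewrite inE gL // wy => /eqP-> E.
by move: (fC z zL); rewrite E !inE eqxx.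
Qed.

End Contraction.

(** * Reducible configurations *)

Section Configurations.

Variables (V : finType) (A : {set V}) (g T : rel V) (rk : V -> nat) (k : nat).
Hypotheses (gT2 : partial_2tree A g T rk) (dg : max_deg_le g (2 * k - 3)) (k3 : 2 < k).

Local Notation N := (nbr g).

Let gs : symmetric g. Proof. by case: gT2 => -[]. Qed.
Let gi : irreflexive g. Proof. by case: gT2 => -[]. Qed.
Let gA x y : g x y -> x \in A. Proof. by case: gT2 => _ + _ _; apply. Qed.
Let gT : subrel g T. Proof. by case: gT2. Qed.
Let Tel : elimination T rk. Proof. by case: gT2. Qed.
Let rk_inj : injective rk. Proof. by case: Tel. Qed.

Lemma nbr_subset x : N x \subset A.
Proof. by apply/subsetP => w; rewrite inE gs => /gA. Qed.

Lemma card_set2_le (a b : V) : #|[set a; b]| <= 2.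
Proof. by rewrite cards2; case: (_ != _). Qed.

Lemma hub_reducible h (D W : {set V}) x1 x2 :
  h \in A -> h \notin D -> D \subset A -> #|D| < k -> W \subset N h ->
  x1 \in D -> x2 \in D -> x1 != x2 -> #|D :\: N h| <= 1 ->
  #|N x1 :\: (h |: D)| <= 1 -> #|N x2 :\: (h |: D)| <= 1 ->
  {in N x1 :\: (h |: D) & N x2 :\: (h |: D), forall u w, u != w /\ T u w} ->
  {in D, forall z, #|N z :\: (h |: D)| <= 2} ->
  {in W, forall z, #|[set w in N z | (w != h) && ((w \notin W :|: D) || (rk z < rk w))]| <= 2} ->
  k.-1 <= #|W :|: D| \/ #|N h :\: (W :|: D)| <= k.-1 -> reducible A g T k.
Proof.
move=> hA hD DA cD WN x1D x2D x12 DN o1 o2 o12 oD oW WD.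
have [|Z [ZWD cZ Zlow]] := @lowest_subset V rk (W :\: D) (minn (k.-1 - #|D|) #|W :\: D|) rk_inj.
  by rewrite geq_minr.
have ZW : Z \subset W by apply: subset_trans ZWD (subsetDl _ _).
have ZD : [disjoint D & Z].
  rewrite disjoint_sym disjoints_subset; apply: subset_trans ZWD _.
  by apply/subsetP => z; rewrite !inE => /andP[].
have hZ : h \notin Z.
  by apply/negP => /(subsetP ZW)/(subsetP WN); rewrite inE gi.
have cDZ : #|D :|: Z| = #|D| + #|Z| by rewrite cardsU disjoint_setI0 // cards0 subn0.
have hDZ : h \notin D :|: Z by rewrite inE negb_or hD.
pose S := h |: (D :|: Z).
have sub1 : h |: D \subset S by rewrite setUS // subsetUl.
have outS z : N z :\: S \subset N z :\: (h |: D) by apply: setDS.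
have leout z m : #|N z :\: (h |: D)| <= m -> #|N z :\: S| <= m.
  by apply: leq_trans; apply: subset_leq_card.
exists S, x1, x2, h, h; split.
- rewrite subUset sub1set hA subUset DA /=.
  by apply: subset_trans ZW _; apply: subset_trans WN (nbr_subset h).
- rewrite cardsU1 hDZ cDZ cZ; move: cD; clear -k3; lia.
- by rewrite !inE x1D x2D !orbT.
- split; [exact: leout|exact: leout|].
  by move=> u w uO wO; apply: o12; apply: (subsetP (outS _)).
move=> z; rewrite !in_setU1 in_setU => /or3P[/eqP->|zD|zZ] _ _.
- constructor 2; split=> //.
  suff: #|N h :\: S| <= k.-1 by move: k3; clear; lia.
  have [full|short] := leqP (k.-1 - #|D|) #|W :\: D|.
    have NhS : #|D| + #|Z| - 1 <= #|N h :&: S|.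
      apply: (@leq_trans #|(D :&: N h) :|: Z|); last first.
        apply/subset_leq_card/subsetP => w; rewrite !inE => /orP[/andP[-> ->]|wZ].
          by rewrite orbT.
        by rewrite wZ !orbT andbT; have := subsetP WN w (subsetP ZW w wZ); rewrite inE.
      have -> : #|(D :&: N h) :|: Z| = #|D :&: N h| + #|Z|.
        have /disjoint_setI0 dZ : [disjoint D :&: N h & Z].
          by apply: disjointWl ZD; apply: subsetIl.
        by rewrite cardsU dZ cards0 subn0.
      by have := cardsID (N h) D; move: DN; clear; lia.
    have := cardsID S (N h); have := dg h; move: NhS; rewrite cZ (minn_idPl full).
    move: cD; clear -k3; lia.
  have ZE : Z = W :\: D.
    by apply/eqP; rewrite eqEcard ZWD cZ leq_min leqnn (ltnW short).
  case: WD => [WD|WD].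
    have := cardsID D W; have := cardsU W D.
    by move: short WD cD; rewrite setIC; clear; lia.
  apply: leq_trans WD; apply/subset_leq_card/subsetP => w.
  rewrite /S ZE !inE !negb_or negb_and negbK => /andP[/and3P[_ wD wW] ->]; rewrite andbT wD andbT.
  by move: wW; rewrite (negPf wD).
- by constructor 1; apply: leout; apply: oD.
constructor 1; apply: leq_trans (oW z (subsetP ZW z zZ)).
apply/subset_leq_card/subsetP => w; rewrite !inE !negb_or => /andP[/and3P[-> wD wZ] gzw].
rewrite gzw wD andbT /=; have [wW|//] := boolP (w \in W).
rewrite ltn_neqAle leqNgt; apply/andP; split.
  by apply: contraTneq gzw => /rk_inj ->; rewrite gi.
by apply: contra wZ => /Zlow; apply=> //; rewrite inE wD.
Qed.

Lemma pair_reducible x1 v1 t1 x2 v2 t2 : 3 < k -> uniq [:: x1; v1; x2; v2] ->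
  g x1 v1 -> g x2 v2 -> N x1 \subset [set v1; t1] -> N x2 \subset [set v2; t2] ->
  t1 != t2 -> T t1 t2 -> #|N v1| < k -> #|N v2| < k -> reducible A g T k.
Proof.
move=> k4 un g1 g2 N1 N2 t12 T12 c1 c2.
have sub (x v t : V) (S : {set V}) : N x \subset [set v; t] -> v \in S -> N x :\: S \subset [set t].
  move=> h vS; apply/subsetP => w; rewrite in_setD => /andP[wS /(subsetP h)].
  by rewrite !inE => /orP[/eqP wv|//]; rewrite wv vS in wS.
have out (x v : V) (S : {set V}) : g x v -> x \in S -> #|N v| < k -> #|N v :\: S| < k.-1.
  move=> gxv xS cv.
  have : #|N v :&: S| > 0 by rewrite card_gt0; apply/set0Pn; exists x; rewrite !inE gs gxv.
  by have := cardsID S (N v); move: cv; clear -k3; lia.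
pose S := [set z in [:: x1; v1; x2; v2]].
have s1 : N x1 :\: S \subset [set t1] by apply: sub N1 _; rewrite !inE eqxx orbT.
have s2 : N x2 :\: S \subset [set t2] by apply: sub N2 _; rewrite !inE eqxx !orbT.
exists S, x1, x2, v1, v2; split.
- apply/subsetP => z; rewrite !inE => /or4P[]/eqP->.
  + exact: gA g1. + by move: g1; rewrite gs => /gA.
  + exact: gA g2. + by move: g2; rewrite gs => /gA.
- by rewrite cardsE (card_uniqP un).
- split; rewrite ?inE ?eqxx ?orbT //.
  by move: un; rewrite /= !inE !negb_or => /andP[/and3P[]].
- split; [rewrite -(cards1 t1)|rewrite -(cards1 t2)|]; do ?exact: subset_leq_card.
  by move=> u w /(subsetP s1)/set1P-> /(subsetP s2)/set1P->.
move=> z; rewrite !inE => /or4P[]/eqP-> zx1 zx2; rewrite ?eqxx // in zx1 zx2.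
  constructor 2; split=> //.
  by apply: leq_trans (out x1 v1 S g1 _ c1) (leq_pred _); rewrite !inE eqxx.
by constructor 3; split=> //; apply: (out x2) => //; rewrite !inE eqxx !orbT.
Qed.

Lemma hub_pair_reducible y x v t l (L : {set V}) : 3 < k ->
  y \in A -> g x v -> N x \subset [set v; t] -> #|N v| < k -> x != y -> v != y ->
  L \subset N y -> l \in L -> x \notin L -> v \notin L ->
  {in L, forall z, #|N z :\ y| <= 2} -> #|N l :\ y| <= 1 ->
  {in N l :\ y, forall w, t != w /\ T t w} ->
  #|N y :\: L| + (#|L| - (k - 3)) < k -> reducible A g T k.
Proof.
move=> k4 yA gxv Nx cv xy vy LN lL xL vL oL ol lP cy.
have [|Z0 [Z0L cZ0 _]] := @lowest_subset V rk (L :\ l) (minn (k - 4) #|L :\ l|) rk_inj.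
  by rewrite geq_minr.
pose Z := l |: Z0.
have lZ0 : l \notin Z0 by apply/negP => /(subsetP Z0L); rewrite !inE eqxx.
have ZL : Z \subset L by rewrite subUset sub1set lL; apply: subset_trans Z0L (subsetDl _ _).
have cL : #|L| = #|L :\ l|.+1 by rewrite (cardsD1 l L) lL.
have cZ : #|Z| = minn (k - 3) #|L|.
  by rewrite cardsU1 lZ0 cZ0 cL; clear -k4; lia.
pose S := x |: (v |: (y |: Z)).
have lZ : l \in Z by rewrite !inE eqxx.
have lS : l \in S by rewrite !inE eqxx !orbT.
have sx : N x :\: S \subset [set t].
  apply/subsetP => w; rewrite in_setD => /andP[wS /(subsetP Nx)].
  by rewrite !inE => /orP[/eqP wv|//]; rewrite wv !inE eqxx orbT in wS.
have sy z : N z :\: S \subset N z :\ y.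
  by apply: setDS; rewrite sub1set !inE eqxx !orbT.
exists S, x, l, y, v; split.
- rewrite !subUset !sub1set yA (gA gxv) (gA (_ : g v x)) ?[g v x]gs //=.
  by apply/andP; split; [|apply: subset_trans Z0L _; apply: subset_trans (subsetDl _ _) _];
     [apply: (subsetP (nbr_subset y)); apply: (subsetP LN)|apply: subset_trans LN (nbr_subset y)].
- have : #|S| <= 3 + #|Z|.
    by rewrite !cardsU1; clear; case: (_ \notin _); case: (_ \notin _); case: (_ \notin _); lia.
  rewrite cZ; clear -k4; lia.
- split=> //; first by rewrite !inE eqxx.
  by apply: contraNneq xL => ->.
- split; [rewrite -(cards1 t)| |].
  + exact: subset_leq_card.
  + by apply: leq_trans ol; apply: subset_leq_card.
  move=> u w /(subsetP sx)/set1P-> /(subsetP (sy l)); exact: lP.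
move=> z; rewrite 3!in_setU1 => /or4P[/eqP->|/eqP->|/eqP->|zZ] zx zl; first by rewrite eqxx in zx.
- constructor 3; split=> //.
  have : #|N v :&: S| > 0 by rewrite card_gt0; apply/set0Pn; exists x; rewrite !inE gs gxv eqxx.
  by have := cardsID S (N v); move: cv; clear -k4; lia.
- constructor 2; split=> //; apply: leq_ltn_trans cy.
  apply: (@leq_trans #|(N y :\: L) :|: (L :\: Z)|).
    apply/subset_leq_card/subsetP => w; rewrite in_setU !in_setD => /andP[wS ->].
    case: (w \in L) => //=; rewrite andbT.
    by apply: contra wS => wZ; rewrite /S 3!in_setU1 wZ !orbT.
  apply: leq_trans (leq_card_setU _ _) _; rewrite leq_add2l cardsD (setIidPr ZL) cZ.
  by clear; lia.
constructor 1; apply: leq_trans (oL z (subsetP ZL z zZ)).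
exact: subset_leq_card.
Qed.

Lemma adjacent_twin_reducible y q (L : {set V}) : g y q -> k - 2 <= #|L| ->
  {in L, forall l, N l = [set y; q]} -> reducible A g T k.
Proof.
move=> gyq cL0 NL0.
have [L1 [L1L cL _]] := lowest_subset rk_inj cL0.
have NL l : l \in L1 -> N l = [set y; q] by move=> /(subsetP L1L)/NL0.
have gL l z : l \in L1 -> g l z = (z == y) || (z == q).
  by move=> /NL/setP/(_ z); rewrite !inE.
have yq : y != q by apply: contraTneq gyq => ->; rewrite gi.
have yL : y \notin L1 by apply/negP => h; have := gL y y h; rewrite gi eqxx.
have qL : q \notin L1 by apply/negP => h; have := gL q q h; rewrite gi eqxx orbT.
pose S := y |: (q |: L1).
have cS : #|S| = k by rewrite !cardsU1 !in_setU1 negb_or yq yL qL cL; clear -k3; lia.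
have out0 l : l \in L1 -> N l :\: S = set0.
  by move=> /NL ->; apply/setP => w; rewrite !inE; case: (w == y); case: (w == q); rewrite ?andbF.
have outq a b : g a b -> a \in S -> b \in S -> L1 \subset N a -> b \notin L1 -> #|N a :\: S| <= k - 2.
  move=> gab aS bS LN bL.
  have : #|b |: L1| <= #|N a :&: S|.
    apply/subset_leq_card/subsetP => w; rewrite in_setU1 => /orP[/eqP->|wL].
      by rewrite !inE gab; move: bS; rewrite !inE.
    by rewrite inE (subsetP LN) // !inE wL !orbT.
  rewrite cardsU1 bL cL; have := cardsID S (N a); have := dg a; clear -k3; lia.
have LNy : L1 \subset N y by apply/subsetP => l lL; rewrite inE gs gL // eqxx.
have LNq : L1 \subset N q by apply/subsetP => l lL; rewrite inE gs gL // eqxx orbT.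
have yS : y \in S by rewrite !inE eqxx.
have qS : q \in S by rewrite !inE eqxx orbT.
have oy := outq y q gyq yS qS LNy qL.
have oq : #|N q :\: S| <= k - 2 by apply: (outq q y) => //; rewrite gs.
have SA : S \subset A.
  rewrite !subUset !sub1set (gA gyq) (gA (_ : g q y)) ?[g q y]gs //=.
  exact: subset_trans LNy (nbr_subset y).
have [l lL] : exists l, l \in L1.
  by apply/set0Pn; rewrite -card_gt0 cL; clear -k3; lia.
have lS : l \in S by rewrite !inE lL !orbT.
have ly : l != y by apply: contraNneq yL => <-.
have [k4|k4] := ltnP 3 k; last first.
  exists S, l, y, q, q; split=> //; first by rewrite cS.
    split; rewrite ?(out0 l) ?cards0 //; first by move: oy; clear -k4; lia.
    by move=> u w; rewrite inE.
  move=> z; rewrite !in_setU1 => /or3P[/eqP->|/eqP->|zL] zl zy; first by rewrite eqxx in zy.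
    by constructor 2; split=> //; move: oq; clear -k3; lia.
  by constructor 1; rewrite out0 // cards0.
have [l' ] : exists l', l' \in L1 :\ l.
  by apply/set0Pn; rewrite -card_gt0; have := cardsD1 l L1; rewrite lL cL; clear -k4; lia.
rewrite in_setD1 => /andP[l'l l'L].
exists S, l, l', q, y; split=> //; first by rewrite cS.
- by split; rewrite 1?eq_sym // !inE l'L !orbT.
- split; rewrite ?(out0 l) ?(out0 l') ?cards0 //.
  by move=> u w; rewrite inE.
move=> z; rewrite !in_setU1 => /or3P[/eqP->|/eqP->|zL] zl zl'.
- by constructor 3; split=> //; move: oy; clear -k3; lia.
- by constructor 2; split=> //; move: oq; clear -k3; lia.
by constructor 1; rewrite out0 // cards0.
Qed.

End Configurations.

(** * Elimination *)

Lemma two_vertices_reducible (V : finType) (A : {set V}) (g T : rel V) k a b : 1 < k ->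
  a \in A -> b \in A -> a != b ->
  nbr g a \subset [set b] -> nbr g b \subset [set a] -> reducible A g T k.
Proof.
move=> k1 aA bA ab Na Nb.
have oa : nbr g a :\: [set a; b] = set0.
  by apply/eqP; rewrite setD_eq0; apply: subset_trans Na _; rewrite sub1set !inE eqxx orbT.
have ob : nbr g b :\: [set a; b] = set0.
  by apply/eqP; rewrite setD_eq0; apply: subset_trans Nb _; rewrite sub1set !inE eqxx.
exists [set a; b], a, b, a, a; split.
- by rewrite subUset !sub1set aA.
- by rewrite cards2 ab.
- by rewrite !inE !eqxx orbT.
- by rewrite oa ob cards0; split=> // u w; rewrite inE.
by move=> z; rewrite in_set2 => /orP[]/eqP-> h1 h2; [rewrite eqxx in h1|rewrite eqxx in h2].
Qed.

Lemma edgeless_reducible (V : finType) (A : {set V}) (g T : rel V) k : 1 < k -> 1 < #|A| ->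
  {in A, forall x, nbr g x = set0} -> reducible A g T k.
Proof.
move=> k1 A2 iso.
have [a aA] : exists a, a \in A by apply/set0Pn; rewrite -card_gt0 ltnW.
have [b] : exists b, b \in A :\ a.
  by apply/set0Pn; rewrite -card_gt0; move: A2; rewrite (cardsD1 a) aA.
rewrite in_setD1 eq_sym => /andP[ab bA].
by apply: (two_vertices_reducible T k1 aA bA ab); rewrite iso // sub0set.
Qed.

Section Pieces.

Variables (V : finType) (A : {set V}) (g T : rel V) (rk : V -> nat) (k : nat).
Hypotheses (gT2 : partial_2tree A g T rk) (dg : max_deg_le g (2 * k - 3)) (k3 : 2 < k).

Local Notation N := (nbr g).

Let gs : symmetric g. Proof. by case: gT2 => -[]. Qed.
Let gi : irreflexive g. Proof. by case: gT2 => -[]. Qed.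
Let gA x y : g x y -> x \in A. Proof. by case: gT2 => _ + _ _; apply. Qed.
Let gT : subrel g T. Proof. by case: gT2. Qed.
Let Tel : elimination T rk. Proof. by case: gT2. Qed.
Let Ts : symmetric T. Proof. by case: Tel. Qed.
Let rk_inj : injective rk. Proof. by case: Tel. Qed.

Definition boundary (D : {set V}) := [set w | (w \notin D) && [exists z in D, g z w]].

Definition is_tail (D : {set V}) := [exists c, exists c',
  [&& c != c', D == [set c; c'] & N c' == [set c]]].

(* The vertex [x] is a leaf of the bunch: only its neighbour [v] and the base
   [t] can be adjacent to it. *)
Definition is_bunch (D : {set V}) t := [&& #|D| <= k - 2, D \subset N t &
  [exists x, exists v, [&& x \in D, v \in D, g x v & N x \subset [set v; t]]]].

Definition good_piece (D : {set V}) : Prop :=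
  [\/ #|D| = 1, is_tail D | exists t, is_bunch D t].

(* [R] is the set of vertices that are not yet eliminated, and [pc x] is the
   piece containing the eliminated vertex [x]. *)
Definition state (R : {set V}) (pc : V -> {set V}) : Prop :=
  [/\ R \subset A, forall x y, x \in A :\: R -> y \in R -> rk x < rk y,
      forall x, x \in A :\: R ->
        [/\ x \in pc x, pc x \subset A :\: R & {in pc x, forall z, pc z = pc x}] &
      forall x, x \in A :\: R ->
        [/\ boundary (pc x) \subset R, #|boundary (pc x)| <= 2,
            {in boundary (pc x) &, forall u w, u != w -> T u w} & good_piece (pc x)]].

Lemma in_boundary (D : {set V}) z w : z \in D -> g z w -> w \in D \/ w \in boundary D.
Proof.
move=> zD gzw; have [|wD] := boolP (w \in D); [by left|right].
by rewrite inE wD; apply/existsP; exists z; rewrite zD.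
Qed.

Section Step.

Variables (R : {set V}) (pc : V -> {set V}) (y : V).
Hypotheses (st : state R pc) (yR : y \in R) (ymin : {in R, forall w, rk y <= rk w}).

Let RA : R \subset A. Proof. by case: st. Qed.
Let yA : y \in A. Proof. exact: subsetP RA y yR. Qed.
Let ltR x w : x \in A :\: R -> w \in R -> rk x < rk w.
Proof. by case: st => _ + _ _; apply. Qed.
Let pcx x : x \in A :\: R -> x \in pc x.
Proof. by case: st => _ _ h _ /h[]. Qed.
Let pcA x : x \in A :\: R -> pc x \subset A :\: R.
Proof. by case: st => _ _ h _ /h[]. Qed.
Let pcE x z : x \in A :\: R -> z \in pc x -> pc z = pc x.
Proof. by case: st => _ _ h _ /h[_ _]; apply. Qed.
Let bdR x : x \in A :\: R -> boundary (pc x) \subset R.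
Proof. by case: st => _ _ _ h /h[]. Qed.
Let bd2 x : x \in A :\: R -> #|boundary (pc x)| <= 2.
Proof. by case: st => _ _ _ h /h[]. Qed.
Let bdT x u w : x \in A :\: R -> u \in boundary (pc x) -> w \in boundary (pc x) ->
  u != w -> T u w.
Proof. by case: st => _ _ _ h /h[_ _ + _]; apply. Qed.
Let pc_good x : x \in A :\: R -> good_piece (pc x).
Proof. by case: st => _ _ _ h /h[]. Qed.

Let K := [set z in A :\: R | y \in boundary (pc z)].
Let U := [set w in R | T y w & rk y < rk w].

Let KA z : z \in K -> z \in A :\: R. Proof. by rewrite inE => /andP[]. Qed.
Let Ky z : z \in K -> y \in boundary (pc z). Proof. by rewrite inE => /andP[]. Qed.

Let U_upper : U \subset upper T rk y.
Proof. by apply/subsetP => w; rewrite !inE => /and3P[_ -> ->]. Qed.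

Let U2 : #|U| <= 2.
Proof. by case: Tel => _ _ h _; apply: leq_trans (h y); apply: subset_leq_card. Qed.

Let UT u w : u \in y |: U -> w \in y |: U -> u != w -> T u w.
Proof.
have yU w' : w' \in U -> T y w' by rewrite inE => /and3P[].
rewrite !in_setU1 => /orP[/eqP->|uU] /orP[/eqP->|wU] uw; first by rewrite eqxx in uw.
- exact: yU.
- by rewrite Ts; apply: yU.
- by case: Tel => _ _ _ /(_ y) h; apply: h => //; apply: (subsetP U_upper).
Qed.

Let yK : y \notin K.
Proof. by apply/negP => /KA; rewrite inE yR. Qed.

Let yU : y \notin U.
Proof. by rewrite inE ltnn !andbF. Qed.


Let bdU z : z \in K -> boundary (pc z) \subset y |: U.
Proof.
move=> zK; apply/subsetP => w wb; rewrite in_setU1.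
have [//|wy] := eqVneq w y.
have wR := subsetP (bdR (KA zK)) w wb.
rewrite inE wR (bdT (KA zK) (Ky zK) wb) 1?eq_sym //= ltn_neqAle ymin // andbT.
by apply: contraNneq wy => /rk_inj ->.
Qed.

Let pcK z : z \in K -> pc z \subset K.
Proof.
move=> zK; apply/subsetP => u uz; rewrite inE (subsetP (pcA (KA zK))) //=.
by rewrite (pcE (KA zK) uz) Ky.
Qed.

Let Ny : N y \subset K :|: U.
Proof.
apply/subsetP => w; rewrite inE => gyw.
have wA : w \in A by apply: (gA (y := y)); rewrite gs.
have [wR|wR] := boolP (w \in R).
  rewrite in_setU; apply/orP; right; rewrite inE wR gT //= ltn_neqAle ymin // andbT.
  by apply: contraTneq gyw => /rk_inj <-; rewrite gi.
have wAR : w \in A :\: R by rewrite inE wR.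
rewrite in_setU inE wAR /=; apply/orP; left.
have gwy : g w y by rewrite gs.
case: (in_boundary (pcx wAR) gwy) => // /(subsetP (pcA wAR)).
by rewrite inE yR.
Qed.

Let NK z w : z \in K -> g z w -> w \in pc z \/ w \in boundary (pc z).
Proof. by move=> zK; apply: in_boundary; apply/pcx/KA. Qed.

Let up2 z : #|[set w in N z | rk z < rk w]| <= 2.
Proof. exact: card_upper gT Tel. Qed.

Lemma step_state : good_piece (y |: K) -> exists pc', state (R :\ y) pc'.
Proof.
move=> good; pose Dy := y |: K.
have AR' : A :\: (R :\ y) = y |: (A :\: R).
  by apply/setP => z; rewrite !inE; case: eqP => [->|_] //=; rewrite yA.
have bdDy : boundary Dy \subset U.
  apply/subsetP => w; rewrite inE => /andP[wD /existsP[z /andP[zD gzw]]].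
  move: zD wD; rewrite !in_setU1 negb_or => /orP[/eqP zy|zK] /andP[wy wK].
    move: gzw; rewrite zy => gyw; have := subsetP Ny w.
    by rewrite [w \in N y]inE gyw in_setU (negPf wK); apply.
  case: (NK zK gzw) => [/(subsetP (pcK zK)) wK'|/(subsetP (bdU zK))].
    by rewrite wK' in wK.
  by rewrite in_setU1 (negPf wy).
have UR : U \subset R :\ y.
  apply/subsetP => w wU; rewrite in_setD1 (contraTneq _ wU) => [|->]; last exact: yU.
  by move: wU; rewrite inE => /and3P[].
have DyA : Dy \subset A :\: (R :\ y).
  by rewrite AR' setUS //; apply/subsetP => z; apply: KA.
exists (fun z => if z \in Dy then Dy else pc z); split.
- exact: subset_trans (subsetDl _ _) RA.
- move=> x w; rewrite AR' in_setU1 in_setD1 => /orP[/eqP->|xA] /andP[wy wR].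
    by rewrite ltn_neqAle ymin // andbT; apply: contraNneq wy => /rk_inj ->.
  exact: ltR.
- move=> x; have [xD _|xD] := boolP (x \in Dy).
    by split=> // z ->.
  rewrite AR' in_setU1 => /orP[xy|xAR]; first by rewrite in_setU1 xy in xD.
  have xK : y \notin boundary (pc x).
    by apply: contra xD => yb; rewrite in_setU1 inE xAR yb orbT.
  split; first exact: pcx.
    by apply: subset_trans (pcA xAR) (subsetUr _ _).
  move=> z zx; rewrite ifN; first exact: pcE.
  rewrite in_setU1 negb_or inE (pcE xAR zx) (negPf xK) andbF andbT.
  by apply: contraTneq zx => ->; apply/negP => /(subsetP (pcA xAR)); rewrite inE yR.
move=> x; have [xD _|xD] := boolP (x \in Dy).
  split=> //.
  - exact: subset_trans bdDy UR.
  - by apply: leq_trans U2; apply: subset_leq_card.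
  move=> u w /(subsetP bdDy) uU /(subsetP bdDy) wU; apply: UT; rewrite in_setU1 ?uU ?wU orbT //.
rewrite AR' in_setU1 => /orP[xy|xAR]; first by rewrite in_setU1 xy in xD.
have xK : y \notin boundary (pc x).
  by apply: contra xD => yb; rewrite in_setU1 inE xAR yb orbT.
split.
- apply/subsetP => w wb; rewrite in_setD1 (subsetP (bdR xAR)) // andbT.
  by apply: contraNneq xK => <-.
- exact: bd2.
- by move=> u w; apply: bdT.
- exact: pc_good.
Qed.

Let conclusion := reducible A g T k \/ twin_reducible g T rk k.

Let bunchP z t : z \in K -> is_bunch (pc z) t -> exists x v,
  [/\ x \in pc z, v \in pc z, x != v, g x v & N x \subset [set v; t]] /\
  [/\ #|N v| < k, t \in boundary (pc z), pc z \subset N t, #|pc z| <= k - 2 & 3 < k].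
Proof.
move=> zK /and3P[cD DN /existsP[x /existsP[v /and4P[xD vD gxv Nx]]]].
have xv : x != v by apply: contraTneq gxv => ->; rewrite gi.
have D2 : 2 <= #|pc z|.
  have := cards2 x v; rewrite xv => <-; apply/subset_leq_card/subsetP => w.
  by rewrite !inE => /orP[]/eqP->.
exists x, v; split=> //; split=> //.
- apply: (@leq_ltn_trans #|(pc z :\ v) :|: boundary (pc z)|).
    apply/subset_leq_card/subsetP => w; rewrite inE => gvw.
    have vK := subsetP (pcK zK) v vD.
    rewrite in_setU in_setD1 -(pcE (KA zK) vD).
    have -> : w != v by apply: contraTneq gvw => ->; rewrite gi.
    by case: (NK vK gvw) => ->; rewrite ?orbT.
  apply: leq_ltn_trans (leq_card_setU _ _) _; have := bd2 (KA zK).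
  by have := cardsD1 v (pc z); rewrite vD; move: D2 cD; clear -k3; lia.
- rewrite inE; apply/andP; split.
    by apply/negP => /(subsetP DN); rewrite inE gi.
  by apply/existsP; exists x; rewrite xD gs; have := subsetP DN x xD; rewrite inE.
- by move: D2 cD; clear; lia.
Qed.

Let bunch_pair z1 z2 t1 t2 : z1 \in K -> z2 \in K -> t1 != t2 ->
  is_bunch (pc z1) t1 -> is_bunch (pc z2) t2 -> conclusion.
Proof.
move=> z1K z2K t12 b1 b2.
have [x1 [v1 [[x1D v1D xv1 g1 N1] [c1 t1b D1N _ k4]]]] := bunchP z1K b1.
have [x2 [v2 [[x2D v2D xv2 g2 N2] [c2 t2b D2N _ _]]]] := bunchP z2K b2.
have pc12 : pc z1 != pc z2.
  apply/eqP => E; rewrite -E in D2N t2b.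
  have := subsetP D2N x1 x1D; rewrite inE gs => gxt.
  have := subsetP N1 t2; rewrite !inE gxt => /(_ isT) /orP[/eqP E2|]; last by rewrite eq_sym (negPf t12).
  by move: t2b; rewrite E2 inE v1D.
have disj a b : a \in pc z1 -> b \in pc z2 -> a != b.
  move=> a1 b2'; apply: contraNneq pc12 => ab.
  by rewrite -(pcE (KA z1K) a1) ab (pcE (KA z2K) b2').
left; apply: (pair_reducible gT2 k3 k4 _ g1 g2 N1 N2 t12) => //.
  by rewrite /= !inE !negb_or xv1 xv2 !disj.
by apply: UT => //; [apply: (subsetP (bdU z1K))|apply: (subsetP (bdU z2K))].
Qed.

Let fill_bunch z t h (W D : {set V}) : z \in K -> is_bunch (pc z) t -> pc z \subset W ->
  #|[set w in N z | (w != h) && ((w \notin W :|: D) || (rk z < rk w))]| <= 2.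
Proof.
move=> zK bz zW; apply: leq_trans (up2 z); apply/subset_leq_card/subsetP => w.
rewrite !inE => /and3P[gzw _ /orP[|->]]; last by rewrite gzw.
rewrite gzw negb_or => /andP[wW _]; case: (NK zK gzw) => [/(subsetP zW)|]; first by rewrite (negPf wW).
by move=> /(subsetP (bdR (KA zK))); apply: ltR; apply: KA.
Qed.

Let fill_small z h (W D : {set V}) : #|N z :\ h| <= 2 ->
  #|[set w in N z | (w != h) && ((w \notin W :|: D) || (rk z < rk w))]| <= 2.
Proof.
apply: leq_trans; apply/subset_leq_card/subsetP => w.
by rewrite in_setD1 inE => /and3P[-> ->].
Qed.

Let hub_base q z (W : {set V}) : z \in K -> is_bunch (pc z) q -> q \in A ->
  pc z \subset W -> W \subset N q ->
  {in W, forall u, #|[set w in N u | (w != q) && ((w \notin W :|: pc z) || (rk u < rk w))]| <= 2} ->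
  k.-1 <= #|W| \/ #|N q :\: W| <= k.-1 -> conclusion.
Proof.
move=> zK bz qA zW WN oW cW.
have [x [v [[xD vD xv gxv Nx] [cv qb DN cD k4]]]] := bunchP zK bz.
have outD u : u \in pc z -> N u :\: (q |: pc z) \subset boundary (pc z) :\ q.
  move=> uD; apply/subsetP => w; rewrite in_setD in_setU1 negb_or in_setD1 inE => /andP[/andP[-> wD] guw].
  by case: (in_boundary uD guw) => // h; rewrite h in wD.
have bq : #|boundary (pc z) :\ q| <= 1.
  by have := cardsD1 q (boundary (pc z)); rewrite qb; have := bd2 (KA zK); clear; lia.
have ox : N x :\: (q |: pc z) = set0.
  apply/eqP; rewrite -subset0; apply/subsetP => w; rewrite in_setD in_setU1 negb_or.
  by move=> /andP[/andP[wq wD]] /(subsetP Nx); rewrite !inE (negPf wq) orbF => /eqP E; rewrite E vD in wD.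
left; apply: (@hub_reducible V A g T rk k gT2 dg k3 q (pc z) W x v) => //.
- by move: qb; rewrite inE => /andP[].
- by apply: subset_trans (pcA (KA zK)) (subsetDl _ _).
- by move: cD; clear -k3; lia.
- by move: DN; rewrite -setD_eq0 => /eqP->; rewrite cards0.
- by rewrite ox cards0.
- by apply: leq_trans bq; apply/subset_leq_card/outD.
- by move=> u w; rewrite ox inE.
- by move=> u /outD/subset_leq_card le_u; apply: leq_trans (leq_trans le_u bq) _.
- by rewrite (setUidPl zW).
Qed.


Let single_piece z : z \in K -> #|pc z| = 1 ->
  [/\ g y z, N z \subset y |: U, #|N z| <= 2 & #|N z :\ y| <= 1].
Proof.
move=> zK /eqP/cards1P[c pcz].
have zc : pc z = [set z] by have := pcx (KA zK); rewrite pcz inE => /eqP ->.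
have Nz : N z \subset boundary (pc z).
  apply/subsetP => w; rewrite inE => gzw; case: (NK zK gzw) => //.
  by rewrite zc inE => /eqP wz; rewrite wz gi in gzw.
have gyz : g y z.
  move: (Ky zK); rewrite inE => /andP[_ /existsP[u /andP[]]].
  by rewrite zc inE => /eqP-> ; rewrite gs.
have Nz2 : #|N z| <= 2 by apply: leq_trans (bd2 (KA zK)); apply: subset_leq_card.
split=> //; first exact: subset_trans Nz (bdU zK).
by have := cardsD1 y (N z); rewrite inE gs gyz; move: Nz2; clear; lia.
Qed.

Let tail_piece z : z \in K -> is_tail (pc z) -> exists c c',
  [/\ c != c', pc z = [set c; c'], N c' = [set c], g y c & #|N c :\: [set y; c']| <= 1].
Proof.
move=> zK /existsP[c /existsP[c' /and3P[cc' /eqP pcz /eqP Nc']]].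
have cK : c \in K by apply: (subsetP (pcK zK)); rewrite pcz !inE eqxx.
have cz : c \in pc z by rewrite pcz !inE eqxx.
exists c, c'; split=> //.
  move: (Ky zK); rewrite inE => /andP[_ /existsP[u /andP[]]].
  rewrite pcz in_set2 => /orP[]/eqP->; first by rewrite gs.
  move=> gcy; have : y \in N c' by rewrite inE.
  by rewrite Nc' inE => /eqP yc; move: yK; rewrite yc cK.
apply: (@leq_trans #|boundary (pc z) :\ y|); last first.
  by have := cardsD1 y (boundary (pc z)); rewrite Ky //; have := bd2 (KA zK); clear; lia.
apply/subset_leq_card/subsetP => w; rewrite in_setD in_set2 negb_or in_setD1 inE.
move=> /andP[/andP[-> wc'] gcw] /=; case: (in_boundary cz gcw) => //.
by rewrite pcz in_set2 (negPf wc') orbF => /eqP wc; rewrite wc gi in gcw.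
Qed.

Lemma step_reducible_or_good :
  [\/ reducible A g T k, twin_reducible g T rk k | good_piece (y |: K)].
Proof.
suff [[?|?]|?] : conclusion \/ good_piece (y |: K); [by constructor 1|by constructor 2|by constructor 3|].
have [/existsP[z1 /existsP[z2 /existsP[t1 /existsP[t2 /and5P[z1K z2K t12 b1 b2]]]]]|same0] :=
  boolP [exists z1, exists z2, exists t1, exists t2,
    [&& z1 \in K, z2 \in K, t1 != t2, is_bunch (pc z1) t1 & is_bunch (pc z2) t2]].
  by left; apply: bunch_pair b1 b2.
have same z1 z2 t1 t2 : z1 \in K -> z2 \in K ->
    is_bunch (pc z1) t1 -> is_bunch (pc z2) t2 -> t1 = t2.
  move=> z1K z2K b1 b2; apply/eqP; apply: contraNT same0 => t12.
  by apply/existsP; exists z1; apply/existsP; exists z2; apply/existsP; exists t1;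
     apply/existsP; exists t2; rewrite z1K z2K t12 b1.
pose B := [set z in K | [exists t, is_bunch (pc z) t]].
have BK : B \subset K by apply/subsetP => z; rewrite inE => /andP[].
have inB z t : z \in K -> is_bunch (pc z) t -> z \in B.
  by move=> zK b; rewrite inE zK; apply/existsP; exists t.
have pcB z : z \in B -> pc z \subset B.
  rewrite inE => /andP[zK b]; apply/subsetP => u uz; rewrite inE (pcE (KA zK) uz) b andbT.
  exact: (subsetP (pcK zK)).
have notB z : z \in K -> z \notin B -> #|pc z| = 1 \/ is_tail (pc z).
  move=> zK zB; case: (pc_good (KA zK)) => [|h|[t b]]; [by left|by right|].
  by rewrite (inB z t) in zB.
have light2 z : z \in K -> z \notin B -> g y z -> #|N z :\ y| <= 2.
  move=> zK zB gyz; case: (notB z zK zB) => [/(single_piece zK)[_ _ _ h]|].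
    exact: leq_trans h _.
  move=> /(tail_piece zK)[c [c' [cc' pcz Nc' gyc le1]]].
  have := pcx (KA zK); rewrite pcz in_set2 => /orP[]/eqP zE; subst z; last first.
    by apply: leq_trans (subset_leq_card (subsetDl _ _)) _; rewrite Nc' cards1.
  apply: (@leq_trans #|c' |: (N c :\: [set y; c'])|).
    apply/subset_leq_card/subsetP => w; rewrite in_setD1 in_setU1 in_setD in_set2 negb_or.
    by case: (w == y); case: (w == c'); case: (w \in N c).
  by rewrite cardsU1; move: le1; clear; case: (_ \notin _); lia.
have [/existsP[z /andP[zK bz]]|noy] := boolP [exists z, (z \in K) && is_bunch (pc z) y].
  left; apply: (hub_base (W := N y :&: K) zK bz yA).
  - rewrite subsetI (pcK zK) andbT.
    by have [x [v [_ [_ _ h _ _]]]] := bunchP zK bz.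
  - exact: subsetIl.
  - move=> u; rewrite in_setI inE => /andP[gyu uK].
    have [uB|uB] := boolP (u \in B); last by apply/fill_small/light2.
    move: uB; rewrite inE uK /= => /existsP[t bu].
    have ty := same _ _ _ _ uK zK bu bz; rewrite ty in bu.
    apply: (fill_bunch _ _ uK bu); rewrite subsetI (pcK uK) andbT.
    by have [x [v [_ [_ _ h _ _]]]] := bunchP uK bu.
  right; apply: (@leq_trans #|U|); last by apply: leq_trans U2 _; move: k3; clear; lia.
  apply/subset_leq_card/subsetP => w; rewrite in_setD in_setI negb_and => /andP[/orP[/negPf->//|wK] wy].
  by have := subsetP Ny w wy; rewrite in_setU (negPf wK).
have noy' z t : z \in K -> is_bunch (pc z) t -> t != y.
  by move=> zK b; apply: contraNneq noy => <-; apply/existsP; exists z; rewrite zK.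
have baseU z t : z \in K -> is_bunch (pc z) t -> t \in U.
  move=> zK b; have [x [v [_ [_ tb _ _ _]]]] := bunchP zK b.
  by have := subsetP (bdU zK) t tb; rewrite in_setU1 (negPf (noy' z t zK b)).
have UA u : u \in U -> u \in A by rewrite inE => /and3P[/(subsetP RA)].
have hubB z t (W : {set V}) : z \in K -> is_bunch (pc z) t -> pc z \subset W -> W \subset N t ->
    {in W, forall u, [\/ u \in B /\ pc u \subset W, #|N u| <= 2 | u = y /\ K \subset W]} ->
    k.-1 <= #|W| -> conclusion.
  move=> zK b zW WN oW cW; apply: (hub_base zK b (UA _ (baseU z t zK b)) zW WN); last by left.
  move=> u /oW[[uB uW]|u2|[-> KW]].
  - by move: uB; rewrite inE => /andP[uK /existsP[t' b']]; apply: fill_bunch b' _.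
  - by apply: fill_small; apply: leq_trans u2; apply/subset_leq_card/subsetDl.
  apply: leq_trans (up2 y); apply/subset_leq_card/subsetP => w; rewrite !inE => /and3P[gyw _].
  rewrite gyw negb_or => /orP[/andP[wW _]|//]; have := subsetP Ny w; rewrite inE in_setU gyw.
  have -> : (w \in K) = false by apply: contraNF wW; apply: (subsetP KW).
  by move=> /(_ isT); rewrite inE => /and3P[].
have Bbase z t : z \in K -> is_bunch (pc z) t -> B \subset N t.
  move=> zK b; apply/subsetP => u; rewrite inE => /andP[uK /existsP[t' b']].
  have tt := same _ _ _ _ uK zK b' b; rewrite tt in b'.
  have [x [v [_ [_ _ h _ _]]]] := bunchP uK b'.
  exact/(subsetP h)/pcx/KA.
have [cB|cB] := ltnP (k - 2) #|B|.
  have [z zB] : exists z, z \in B by apply/set0Pn; rewrite -card_gt0; apply: leq_trans cB.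
  have := zB; rewrite inE => /andP[zK /existsP[t b]].
  left; apply: (hubB z t B) => //; [exact: pcB|exact: Bbase b| |by move: cB; clear -k3; lia].
  by move=> u uB; constructor 1; split=> //; apply: pcB.
have NyB : #|N y :&: B| <= k - 3.
  have [->|[z zB]] := set_0Vmem B; first by rewrite setI0 cards0.
  have := zB; rewrite inE => /andP[zK /existsP[t b]].
  have [x [v [[xD vD xv gxv Nx] [cv tb DN cD k4]]]] := bunchP zK b.
  have : #|N y :&: B| < #|B|.
    apply: proper_card; rewrite properE subsetIr /=; apply/subsetPn; exists x.
      exact: (subsetP (pcB z zB)).
    apply/negP; rewrite in_setI inE gs => /andP[gxy _].
    have := subsetP Nx y; rewrite inE gxy => /(_ isT).
    rewrite in_set2 => /orP[/eqP yv|/eqP yt].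
      by move: yK; rewrite yv (subsetP (pcK zK)).
    by move: (noy' z t zK b); rewrite yt eqxx.
  by move: cB; clear -k3; lia.
pose W := [set z in K | (z \notin B) && g y z].
have inW z : z \in W -> [/\ z \in K, z \notin B & g y z] by rewrite inE => /and3P[].
have WN : W \subset N y by apply/subsetP => z /inW[_ _]; rewrite inE.
have NyW : N y :\: W \subset (N y :&: B) :|: U.
  apply/subsetP => w; rewrite in_setD => /andP[wW wy]; have := subsetP Ny w wy.
  rewrite !in_setU in_setI wy => /orP[wK|->]; last by rewrite orbT.
  have [//|wB] := boolP (w \in B).
  by case/negP: wW; rewrite inE wK wB; move: wy; rewrite inE.
have cNyW : #|N y :\: W| <= k.-1.
  apply: leq_trans (subset_leq_card NyW) _; apply: leq_trans (leq_card_setU _ _) _.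
  by move: NyB U2; clear -k3; lia.
have hubW (D : {set V}) x1 x2 : y \notin D -> D \subset K -> #|D| <= 2 ->
    x1 \in D -> x2 \in D -> x1 != x2 -> #|D :\: N y| <= 1 ->
    #|N x1 :\: (y |: D)| <= 1 -> #|N x2 :\: (y |: D)| <= 1 ->
    {in N x1 :\: (y |: D) & N x2 :\: (y |: D), forall u w, u != w /\ T u w} -> conclusion.
  move=> yD DK cD x1D x2D x12 DN o1 o2 o12; left.
  apply: (@hub_reducible V A g T rk k gT2 dg k3 y D W x1 x2) => //.
  - apply: subset_trans DK _; apply/subsetP => z /KA; rewrite inE => /andP[] //.
  - by apply: leq_ltn_trans cD _.
  - move=> z zD; have : z \in [set x1; x2].
      have/eqP -> // : [set x1; x2] == D.
      by rewrite eqEcard cards2 x12 cD andbT; apply/subsetP => w; rewrite in_set2 => /orP[]/eqP->.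
    by rewrite in_set2 => /orP[]/eqP->; [apply: leq_trans o1 _|apply: leq_trans o2 _].
  - by move=> z /inW[zK zB gyz]; apply/fill_small/light2.
  right; apply: leq_trans cNyW; apply/subset_leq_card/setDS; exact: subsetUl.
have [/existsP[z /andP[zK tz]]|notail] := boolP [exists z, (z \in K) && is_tail (pc z)].
  left; have [c [c' [cc' pcz Nc' gyc c1]]] := tail_piece zK tz.
  have yD : y \notin pc z by apply: contra yK; apply: (subsetP (pcK zK)).
  have oc' : N c' :\: (y |: pc z) = set0.
    by rewrite Nc' pcz; apply/setP => w; rewrite !inE; case: (w == c); rewrite ?orbT ?andbF.
  apply: (hubW (pc z) c' c) => //.
  - exact: pcK.
  - by rewrite pcz card_set2_le.
  - by rewrite pcz !inE eqxx orbT.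
  - by rewrite pcz !inE eqxx.
  - by rewrite eq_sym.
  - rewrite -(cards1 c'); apply/subset_leq_card/subsetP => w; rewrite pcz !inE.
    by case/andP => gyw /orP[/eqP wc|//]; rewrite wc gyc in gyw.
  - by rewrite oc' cards0.
  - apply: leq_trans c1; apply/subset_leq_card/setDS; rewrite pcz.
    by apply/subsetP => w; rewrite !inE => /orP[->|->]; rewrite ?orbT.
  by move=> u w; rewrite oc' inE.
have single z : z \in K -> z \notin B -> #|pc z| = 1.
  move=> zK zB; case: (notB z zK zB) => // tz.
  by move: notail => /existsP[]; exists z; rewrite zK.
have KW z : z \in K -> z \notin B -> z \in W.
  move=> zK zB; have [gyz _ _ _] := single_piece zK (single z zK zB).
  by rewrite inE zK zB.
have Wsub z : z \in W -> [/\ N z \subset y |: U, #|N z| <= 2 & #|N z :\ y| <= 1].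
  by move=> /inW[zK zB _]; have [_ ? ? ?] := single_piece zK (single z zK zB).
have hubWB z t l : z \in K -> is_bunch (pc z) t -> l \in W ->
    {in N l :\ y, forall w, t != w /\ T t w} -> #|N y :\: W| + (#|W| - (k - 3)) < k -> conclusion.
  move=> zK b lW lP cW; have [x [v [[xD vD xv gxv Nx] [cv tb DN cD k4]]]] := bunchP zK b.
  have pB u : u \in pc z -> u != y /\ u \notin W.
    move=> uz; split; first by apply: contraNneq yK => <-; apply: (subsetP (pcK zK)).
    by apply/negP => /inW[_ /negP[]]; apply: (subsetP (pcB z (inB z t zK b))).
  have [xy xW] := pB x xD; have [vy vW] := pB v vD; have [l1 l2 l3] := Wsub l lW.
  left; apply: (hub_pair_reducible gT2 k4 yA gxv Nx cv xy vy WN lW xW vW _ l3 lP cW).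
  by move=> u /Wsub[_ _ h]; apply: leq_trans h _.
have [/existsP[c /andP[cW /eqP Nc]]|nopend] := boolP [exists c, (c \in W) && (N c == [set y])].
  have [cK cB' gyc] := inW c cW.
  have oc : N c :\ y = set0 by rewrite Nc setDv.
  have [/existsP[c2 /andP[c2W c2c]]|only] := boolP [exists c2, (c2 \in W) && (c2 != c)].
    left; have [c2K _ gyc2] := inW c2 c2W; have [_ _ c2y] := Wsub c2 c2W.
    have ocD : N c :\: (y |: [set c; c2]) = set0.
      by rewrite Nc; apply/setP => w; rewrite !inE; case: (w == y); rewrite ?andbF.
    apply: (hubW [set c; c2] c c2) => //.
    - rewrite in_set2 negb_or; apply/andP; split; apply: contraNneq yK => E; by rewrite E.
    - by apply/subsetP => w; rewrite in_set2 => /orP[]/eqP->.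
    - exact: card_set2_le.
    - by rewrite !inE eqxx.
    - by rewrite !inE eqxx orbT.
    - by rewrite eq_sym.
    - rewrite (_ : _ :\: _ = set0) ?cards0 //; apply/eqP; rewrite setD_eq0.
      by apply/subsetP => w; rewrite !inE => /orP[]/eqP->.
    - by rewrite ocD cards0.
    - apply: leq_trans c2y; apply/subset_leq_card/setDS.
      by rewrite sub1set !inE eqxx.
    by move=> u w; rewrite ocD inE.
  have WE : W = [set c].
    apply/setP => w; rewrite in_set1; apply/idP/eqP => [wW|->//].
    by apply/eqP; apply: contraNT only => wc; apply/existsP; exists w; rewrite wW.
  have [B0|[z zB]] := set_0Vmem B.
    right; constructor 2; apply/existsP; exists y; apply/existsP; exists c.
    have yc : y != c by apply: contraNneq yK => ->.
    rewrite yc Nc eqxx andbT /=; apply/eqP/setP => w; rewrite in_setU1 in_set2; congr (_ || _).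
    apply/idP/eqP => [wK|->//]; have : w \in W by rewrite KW // B0 inE.
    by rewrite WE => /set1P.
  have := zB; rewrite inE => /andP[zK /existsP[t b]]; left.
  have [x [v [_ [_ _ _ _ k4]]]] := bunchP zK b.
  apply: (hubWB z t c) => //; first by move=> w; rewrite oc inE.
  by rewrite WE cards1 -{1}WE; move: cNyW; clear -k4; lia.
have leaf z : z \in W -> exists2 q, q \in U & N z = [set y; q].
  move=> zW; have [zK zB gyz] := inW z zW; have [zU z2 zy1] := Wsub z zW.
  have yz : y \in N z by rewrite inE gs.
  have [E|[q]] := set_0Vmem (N z :\ y).
    case/existsP: nopend; exists z; rewrite zW -(setD1K yz) E setU0 eqxx //.
  rewrite in_setD1 => /andP[qy qz]; exists q.
    by have := subsetP zU q qz; rewrite in_setU1 (negPf qy).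
  apply/esym/eqP; rewrite eqEcard cards2 eq_sym qy z2 andbT.
  by apply/subsetP => w; rewrite in_set2 => /orP[]/eqP->.
have leafD z q : q != y -> N z = [set y; q] -> N z :\ y = [set q].
  move=> qy ->; apply/setP => w; rewrite !inE; have [->|] //= := eqVneq w y.
  by rewrite eq_sym (negPf qy).
have Uy q : q \in U -> q != y by apply: contraTneq => ->.
have UU q1 q2 : q1 \in U -> q2 \in U -> q1 != q2 -> T q1 q2.
  by move=> q1U q2U; apply: UT; rewrite in_setU1 ?q1U ?q2U orbT.
have [/existsP[l1 /existsP[l2 /and3P[l1W l2W N12]]]|sameW] :=
    boolP [exists l1, exists l2, [&& l1 \in W, l2 \in W & N l1 != N l2]].
  left; have [q1 q1U E1] := leaf l1 l1W; have [q2 q2U E2] := leaf l2 l2W.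
  have q12 : q1 != q2 by apply: contraNneq N12; rewrite E1 E2 => ->.
  have [l1K _ gyl1] := inW l1 l1W; have [l2K _ gyl2] := inW l2 l2W.
  have sub1 (D : {set V}) z q : q \in U -> N z = [set y; q] -> N z :\: (y |: D) \subset [set q].
    move=> qU E; rewrite -(leafD z q) //; last exact: Uy.
    by apply: setDS; rewrite sub1set !inE eqxx.
  have s1 := sub1 [set l1; l2] l1 q1 q1U E1; have s2 := sub1 [set l1; l2] l2 q2 q2U E2.
  apply: (hubW [set l1; l2] l1 l2) => //.
  - rewrite in_set2 negb_or; apply/andP; split; apply: contraNneq yK => E; by rewrite E.
  - by apply/subsetP => w; rewrite in_set2 => /orP[]/eqP->.
  - exact: card_set2_le.
  - by rewrite !inE eqxx.
  - by rewrite !inE eqxx orbT.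
  - by apply: contraNneq N12 => ->.
  - rewrite (_ : _ :\: _ = set0) ?cards0 //; apply/eqP; rewrite setD_eq0.
    by apply/subsetP => w; rewrite !inE => /orP[]/eqP->.
  - by rewrite -(cards1 q1); apply: subset_leq_card.
  - by rewrite -(cards1 q2); apply: subset_leq_card.
  move=> u w /(subsetP s1)/set1P-> /(subsetP s2)/set1P->; split=> //; exact: UU.
have sameN z1 z2 : z1 \in W -> z2 \in W -> N z1 = N z2.
  move=> z1W z2W; apply/eqP; apply: contraNT sameW => h.
  by apply/existsP; exists z1; apply/existsP; exists z2; rewrite z1W z2W.
have [K0|[z0 z0K]] := set_0Vmem K.
  by right; constructor 1; rewrite K0 setU0 cards1.
have KBW z : z \in K -> z \in B \/ z \in W.
  by move=> zK; have [zB|zB] := boolP (z \in B); [left|right; apply: KW].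
have [[z [t [l [q [zK b lW qU [Nl tq]]]]]]|] :
    (exists z t l q, [/\ z \in K, is_bunch (pc z) t, l \in W, q \in U & N l = [set y; q] /\ t != q]) \/
    exists2 q, q \in U & {in B, forall z, is_bunch (pc z) q} /\ {in W, forall z, N z = [set y; q]}.
  have [W0|[l lW]] := set_0Vmem W.
    have z0B : z0 \in B by case: (KBW z0 z0K); rewrite ?W0 ?inE.
    have := z0B; rewrite inE => /andP[_ /existsP[t b]]; right; exists t; first exact: baseU b.
    split=> z; last by rewrite W0 inE.
    by rewrite inE => /andP[zK /existsP[t' b']]; rewrite -(same _ _ _ _ zK z0K b' b).
  have [q qU Nl] := leaf l lW.
  have NW : {in W, forall z, N z = [set y; q]} by move=> z zW; rewrite (sameN z l).
  have [B0|[z zB]] := set_0Vmem B.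
    by right; exists q => //; split=> // z; rewrite B0 inE.
  have := zB; rewrite inE => /andP[zK /existsP[t b]].
  have [tq|tq] := eqVneq t q; last by left; exists z, t, l, q.
  right; exists q => //; split=> // u; rewrite inE => /andP[uK /existsP[t' b']].
  by rewrite -tq -(same _ _ _ _ uK zK b' b).
- left; have tU := baseU z t zK b.
  have NW : {in W, forall z, N z = [set y; q]} by move=> w wW; rewrite (sameN w l).
  have [x [v [_ [_ _ _ _ k4]]]] := bunchP zK b.
  have lP : {in N l :\ y, forall w, t != w /\ T t w}.
    move=> w; rewrite (leafD l q (Uy q qU) Nl) => /set1P->; split=> //; exact: UU.
  have [gyq|gyq] := boolP (g y q).
    have [cW|cW] := leqP (k - 2) #|W|.
      by left; apply: (adjacent_twin_reducible gT2 dg k3 gyq cW NW).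
    by apply: (hubWB z t l) => //; move: cNyW cW; clear -k4; lia.
  have [cW|cW] := leqP k.-1 #|W|.
    right; exists y, q, W; split=> //.
    - by apply: UT; rewrite ?in_setU1 ?eqxx ?qU ?orbT // eq_sym Uy.
    - by move: qU; rewrite inE => /and3P[].
  apply: (hubWB z t l) => //.
  suff : #|N y :\: W| <= k - 2 by move: cW; clear -k4; lia.
  apply: (@leq_trans #|(N y :&: B) :|: (U :\ q)|).
    apply/subset_leq_card/subsetP => w wy; have := subsetP NyW w wy.
    rewrite !in_setU in_setD1; case: (w \in N y :&: B) => //= ->; rewrite andbT.
    by apply: contraNneq gyq => <-; move: wy; rewrite in_setD => /andP[_]; rewrite inE.
  apply: leq_trans (leq_card_setU _ _) _; move: NyB U2; rewrite (cardsD1 q U) qU.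
  by clear -k4; lia.
move=> [q qU [bB NW]].
have KN : K \subset N q.
  apply/subsetP => z zK; case: (KBW z zK) => [zB|/NW Nz].
    exact: (subsetP (Bbase z q zK (bB z zB))).
  have : q \in N z by rewrite Nz !inE eqxx orbT.
  by rewrite !inE gs.
have NKq z : z \in K -> N z :\: (y |: K) \subset [set q].
  move=> zK; apply/subsetP => w; rewrite in_setD in_setU1 negb_or => /andP[/andP[wy wK]].
  case: (KBW z zK) => [zB|/NW->]; last by rewrite in_set2 (negPf wy) inE.
  rewrite [w \in N z]inE => /(NK zK) [/(subsetP (pcK zK)) h|wb]; first by rewrite h in wK.
  have [x [v [_ [_ qb _ _ _]]]] := bunchP zK (bB z zB).
  have yb := Ky zK; have qy := Uy q qU.
  suff/eqP E : [set y; q] == boundary (pc z) by move: wb; rewrite -E in_set2 (negPf wy) inE.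
  rewrite eqEcard cards2 eq_sym qy (bd2 (KA zK)) andbT.
  by apply/subsetP => u; rewrite in_set2 => /orP[]/eqP->.
have Nyq : #|N y :\: (q |: K)| <= 1.
  apply: (@leq_trans #|U :\ q|).
    apply/subset_leq_card/subsetP => w; rewrite in_setD in_setU1 negb_or in_setD1.
    move=> /andP[/andP[-> wK]] /(subsetP Ny).
    by rewrite in_setU (negPf wK).
  by move: U2; rewrite (cardsD1 q U) qU; clear; lia.
have KA' : K \subset A.
  by apply/subsetP => w /KA; rewrite inE => /andP[].
have hubK (W' : {set V}) : W' \subset N q -> K \subset W' -> W' \subset y |: K -> B != set0 ->
    k.-1 <= #|W'| -> conclusion.
  move=> W'N KW' W'K /set0Pn[z zB] cW; have zK := subsetP BK z zB.
  apply: (hubB z q W') => //; first exact: bB.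
    exact: subset_trans (pcK zK) KW'.
  move=> u /(subsetP W'K); rewrite in_setU1 => /orP[/eqP->|uK]; first by constructor 3.
  case: (KBW u uK) => [uB|/NW->]; last by constructor 2; apply: card_set2_le.
  by constructor 1; split=> //; apply: subset_trans (pcK uK) KW'.
have allW : B == set0 -> {in K, forall z, N z = [set y; q]}.
  by move=> /eqP B0 z /KBW[|/NW//]; rewrite B0 inE.
have cyK : #|y |: K| = #|K|.+1 by rewrite cardsU1 yK.
have [gyq|gyq] := boolP (g y q); last first.
  left; have [cK|cK] := leqP k #|K|.+1; last first.
    left; exists (y |: K), y, z0, y, y; split=> //.
    - by rewrite subUset sub1set yA.
    - by rewrite cyK ltnW.
    - by rewrite !in_setU1 eqxx z0K orbT; split=> //; apply: contraNneq yK => ->.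
    - split.
      + apply: leq_trans Nyq; apply/subset_leq_card/subsetP => w; rewrite !in_setD !in_setU1 !negb_or.
        move=> /andP[/andP[wy ->] wN]; rewrite wN !andbT.
        by apply: contraNneq gyq => <-; move: wN; rewrite inE.
      + by rewrite -(cards1 q); apply/subset_leq_card/NKq.
      move=> u w uO /(subsetP (NKq z0 z0K))/set1P->; move: uO.
      rewrite in_setD in_setU1 negb_or => /andP[/andP[uy uK] uN].
      have uU : u \in U by have := subsetP Ny u uN; rewrite in_setU (negPf uK).
      have uq : u != q by apply: contraNneq gyq => <-; move: uN; rewrite inE.
      by split=> //; apply: UU.
    move=> z; rewrite in_setU1 => /orP[/eqP->|zK] zy; first by rewrite eqxx in zy.
    by move=> _; constructor 1; apply: leq_trans (subset_leq_card (NKq z zK)) _; rewrite cards1.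
  have {}cK : k.-1 <= #|K| by move: cK; clear; lia.
  have [B0|B0] := boolP (B == set0); last by apply: (hubK K) => //; apply: subsetUr.
  right; exists y, q, K; split=> //; last exact: allW.
  - by apply: UT; rewrite ?in_setU1 ?eqxx ?qU ?orbT // eq_sym Uy.
  - by move: qU; rewrite inE => /and3P[].
have yKN : y |: K \subset N q by rewrite subUset KN andbT sub1set inE gs.
have [cK|cK] := leqP (k - 2) #|K|.
  left; have [B0|B0] := boolP (B == set0).
    left; exact: (adjacent_twin_reducible gT2 dg k3 gyq cK (allW B0)).
  apply: (hubK (y |: K)) => //; first exact: subsetUr.
  by rewrite cyK; move: cK; clear; lia.
right; constructor 3; exists q; apply/and3P; split=> //.
  by rewrite cyK; move: cK; clear; lia.
have [B0|/set0Pn[z zB]] := boolP (B == set0).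
  apply/existsP; exists z0; apply/existsP; exists y.
  have Nz0 := allW B0 z0 z0K.
  rewrite !in_setU1 eqxx z0K orbT Nz0 subxx andbT /=.
  have : y \in N z0 by rewrite Nz0 !inE eqxx.
  by rewrite inE.
have zK := subsetP BK z zB.
have [x [v [[xD vD xv gxv Nx] _]]] := bunchP zK (bB z zB).
apply/existsP; exists x; apply/existsP; exists v.
by rewrite !in_setU1 (subsetP (pcK zK) x xD) (subsetP (pcK zK) v vD) gxv Nx !orbT.
Qed.

End Step.

Lemma reducible_exists : 1 < #|A| -> reducible A g T k \/ twin_reducible g T rk k.
Proof.
move=> A2.
have run m (R : {set V}) (pc : V -> {set V}) : #|R| = m -> state R pc ->
    (reducible A g T k \/ twin_reducible g T rk k) \/ exists pc', state set0 pc'.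
  elim: m R pc => [|m IH] R pc cR st.
    by right; exists pc; move/eqP: cR; rewrite cards_eq0 => /eqP <-.
  have [y0 y0R] : exists y, y \in R by apply/set0Pn; rewrite -card_gt0 cR.
  pose y := [arg min_(w < y0 in R) rk w].
  have [yR ymin] : y \in R /\ {in R, forall w, rk y <= rk w}.
    by rewrite /y; case: arg_minnP.
  case: (step_reducible_or_good st yR ymin) => [h|h|good].
  - by left; left.
  - by left; right.
  have [pc' st'] := step_state st yR ymin good.
  by apply: IH st'; have := cardsD1 y R; rewrite yR cR => -[].
have st0 : state A (fun _ => set0).
  by split=> // x; rewrite setDv inE.
case: (run _ _ _ erefl st0) => // -[pc [_ _ pcP bdP]]; left.
have bd0 x : x \in A -> boundary (pc x) = set0.
  move=> xA; apply/eqP; rewrite -subset0.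
  by have [|h _ _ _] := bdP x; rewrite ?setD0.
have closed x u w : x \in A -> u \in pc x -> g u w -> w \in pc x.
  by move=> xA ux /(in_boundary ux)[//|]; rewrite bd0 // inE.
have self x : x \in A -> x \in pc x by move=> xA; have [|h _ _] := pcP x; rewrite ?setD0.
have good x : x \in A -> #|pc x| = 1 \/ is_tail (pc x).
  move=> xA; have [|_ _ _ []] := bdP x; rewrite ?setD0; [by []|by left|by right|].
  move=> [t /and3P[_ DN _]]; have := subsetP DN x (self x xA); rewrite inE gs => gxt.
  by have := subsetP DN t (closed x x t xA (self x xA) gxt); rewrite inE gi.
have [/existsP[x /andP[xA]]|notail] := boolP [exists x, (x \in A) && is_tail (pc x)].
  move=> /existsP[c /existsP[c' /and3P[cc' /eqP pcx /eqP Nc']]].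
  have c'c : g c' c by move/setP/(_ c): (Nc'); rewrite !inE eqxx.
  have cA : c \in A by apply: (gA (y := c')); rewrite gs.
  apply: (two_vertices_reducible T (ltnW k3) cA (gA c'c) cc'); last by rewrite Nc'.
  apply/subsetP => w; rewrite [w \in N c]inE => gcw.
  have : w \in pc x by apply: (closed x c) => //; rewrite pcx !inE eqxx.
  rewrite pcx !inE => /orP[/eqP wc|//].
  by rewrite wc gi in gcw.
have iso x : x \in A -> N x = set0.
  move=> xA; case: (good x xA) => [/eqP/cards1P[c pcx]|tx].
    apply/setP => w; rewrite !inE; apply/negP => gxw.
    have := closed x x w xA (self x xA) gxw; have := self x xA.
    by rewrite pcx !inE => /eqP xc /eqP wc; rewrite xc wc gi in gxw.
  by case/existsP: notail; exists x; rewrite xA.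
exact: edgeless_reducible (ltnW k3) A2 iso.
Qed.

End Pieces.

Lemma partial_2tree_equitable (V : finType) (A : {set V}) (g T : rel V) rk k :
  1 < k -> partial_2tree A g T rk -> max_deg_le g (2 * k - 3) ->
  exists alpha : V -> 'I_k, equitable_on A g alpha.
Proof.
move=> k1; have [n] := ubnP #|A|; elim: n A g T => // n IH A g T ltA P dg.
have IH' (A' : {set V}) (g' T' : rel V) : #|A'| < #|A| -> partial_2tree A' g' T' rk ->
    max_deg_le g' (2 * k - 3) -> exists alpha : V -> 'I_k, equitable_on A' g' alpha.
  by move=> lt; apply: (IH A' g' T'); apply: leq_trans lt _; rewrite -ltnS.
have [gP gA gT Tel] := P; have [gs gi] := gP.
have [Ak|/ltnW kA] := leqP #|A| k; first exact: equitable_on_small (ltnW k1) Ak gP gA.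
have red : reducible A g T k \/ twin_reducible g T rk k.
  have A2 := leq_trans k1 kA.
  have [k3|k2] := ltnP 2 k; first exact: (reducible_exists P dg k3 A2).
  have {}k2 : k = 2 by apply/eqP; rewrite eqn_leq k2.
  left; rewrite k2 in dg *.
  have sub a b : g a b -> nbr g a \subset [set b].
    move=> gab; apply/subsetP => w wN; rewrite inE; apply/eqP.
    by apply: (card_le1_eqP (dg a)) => //; rewrite inE.
  have [/existsP[a /existsP[b gab]]|no] := boolP [exists a, exists b, g a b].
    have gba : g b a by rewrite gs.
    apply: (two_vertices_reducible T _ (gA _ _ gab) (gA _ _ gba)) => //; try exact: sub.
    by apply: contraTneq gab => ->; rewrite gi.
  apply: edgeless_reducible => // x _.
  apply/setP => w; rewrite !inE; apply: contraNF no => gxw.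
  by apply/existsP; exists x; apply/existsP; exists w.
case: red => red.
  apply: (reducible_extend P dg kA _ red) => A' g' lt P' d'; exact: IH' lt P' d'.
apply: (twin_reducible_extend k1 _ P dg IH' red).
by clear -k1; lia.
Qed.

(** * Graphs of minimum degree three *)

Section CompleteMinor.

Variables (V : finType) (g : rel V).
Hypotheses (gs : symmetric g) (gi : irreflexive g).

Definition segment (s : seq V) a b := [set x in s | a <= index x s <= b].

Lemma segment_connected (s : seq V) a b : uniq s -> sorted g s -> a <= b < size s ->
  connected_set g (segment s a b).
Proof.
move=> us; case: s us => [|x0 s'] us; first by rewrite ltn0 andbF.
set s := x0 :: s' in us * => /(sortedP x0) ss /andP[ab bs].
have inseg m : a <= m <= b -> nth x0 s m \in segment s a b.
  move=> /andP[am mb]; have ms := leq_ltn_trans mb bs.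
  by rewrite inE mem_nth // index_uniq // am mb.
split; first by apply/set0Pn; exists (nth x0 s a); apply: inseg; rewrite leqnn.
have conn m : a <= m <= b -> connect (induced_edge g (segment s a b)) (nth x0 s a) (nth x0 s m).
  elim: m => [|m IH] /andP[am mb]; first by move: am; rewrite leqn0 => /eqP->.
  move: am; rewrite leq_eqVlt => /orP[/eqP->//|am].
  have amb : a <= m <= b by rewrite -ltnS am ltnW.
  apply: connect_trans (IH amb) _; apply: connect1.
  by rewrite /induced_edge !inseg ?mb ?(ltnW am) //= ss // (leq_ltn_trans mb).
have sym : connect_sym (induced_edge g (segment s a b)).
  apply: sym_connect_sym => x y; rewrite /induced_edge gs.
  by case: (x \in _); case: (y \in _).
have to_nth x : x \in segment s a b -> connect (induced_edge g (segment s a b)) (nth x0 s a) x.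
  rewrite inE => /andP[xs xab]; rewrite -[x in connect _ _ x](nth_index x0 xs).
  exact: conn.
by move=> x y xS yS; apply: connect_trans (to_nth y yS); rewrite sym; apply: to_nth.
Qed.

Lemma crossing_chords_minor (s : seq V) x0 i j m : uniq s -> sorted g s ->
  1 < i -> i < j < size s -> i < m < size s ->
  g (nth x0 s 0) (nth x0 s i) -> g (nth x0 s 0) (nth x0 s j) ->
  g (nth x0 s i.-1) (nth x0 s m) -> has_minor g (@complete_graph 4).
Proof.
move=> us ss i1 /andP[ij js] /andP[im ms] g0i g0j gim.
pose lo := [:: 0; i.-1; i; minn m j]; pose hi := [:: i.-2; i.-1; (minn m j).-1; maxn m j].
pose B (u : 'I_4) := segment s (nth 0 lo u) (nth 0 hi u).
have gstep n : n.+1 < size s -> g (nth x0 s n) (nth x0 s n.+1).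
  by move=> ns; apply: (sortedP x0 ss).
have inB (u : 'I_4) n : n < size s -> nth 0 lo u <= n <= nth 0 hi u -> nth x0 s n \in B u.
  by move=> ns h; rewrite inE mem_nth // index_uniq.
have ord4 (u : 'I_4) : [\/ nat_of_ord u = 0, nat_of_ord u = 1, nat_of_ord u = 2 | nat_of_ord u = 3].
  by case: u => [[|[|[|[|]]]] ?] //; [constructor 1|constructor 2|constructor 3|constructor 4].
exists B; split.
- move=> u; apply: segment_connected => //.
  by case: (ord4 u) => ->; rewrite /lo /hi /=; move: i1 ij js im ms; clear; lia.
- suff dis (u v : 'I_4) : u < v -> [disjoint B u & B v].
    move=> u v; rewrite -val_eqE neq_ltn => /orP[/dis//|/dis].
    by rewrite disjoint_sym.
  move=> uv; rewrite -setI_eq0; apply/eqP/setP => x; rewrite !inE.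
  apply/negP => /andP[/andP[_ /andP[_ xu]] /andP[_ /andP[xv _]]].
  have := leq_trans xv xu; apply/negP; rewrite -ltnNge.
  move: uv; case: (ord4 u) => ->; case: (ord4 v) => -> //= _;
    by move: i1 ij js im ms; clear; lia.
suff edge (u v : 'I_4) : u < v -> exists x y, [/\ x \in B u, y \in B v & g x y].
  move=> u v; rewrite /complete_graph -val_eqE neq_ltn => /orP[/edge//|/edge[x [y [xu yv gxy]]]].
  by exists y, x; rewrite gs.
have mk (a b : nat) : a < size s -> b < size s -> nth 0 lo u <= a <= nth 0 hi u ->
    nth 0 lo v <= b <= nth 0 hi v -> g (nth x0 s a) (nth x0 s b) ->
    exists x y, [/\ x \in B u, y \in B v & g x y].
  by move=> sa sb ua vb gab; exists (nth x0 s a), (nth x0 s b); rewrite !inB.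
move: mk; case: (ord4 u) => ->; case: (ord4 v) => -> //= mk _.
- apply: (mk i.-2 i.-1); try (by move: i1 ij js im ms; clear; lia).
  have -> : i.-1 = i.-2.+1 by move: i1; clear; lia.
  by apply: gstep; move: i1 ij js; clear; lia.
- by apply: (mk 0 i) => //; move: i1 ij js im ms; clear; lia.
- by apply: (mk 0 j) => //; move: i1 ij js im ms; clear; lia.
- apply: (mk i.-1 i); try (by move: i1 ij js im ms; clear; lia).
  have {2}-> : i = i.-1.+1 by move: i1; clear; lia.
  by apply: gstep; move: i1 ij js; clear; lia.
- by apply: (mk i.-1 m) => //; move: i1 ij js im ms; clear; lia.
apply: (mk (minn m j).-1 (minn m j)); try (by move: i1 ij js im ms; clear; lia).
have {2}-> : minn m j = (minn m j).-1.+1 by move: i1 ij im; clear; lia.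
by apply: gstep; move: i1 ij js im ms; clear; lia.
Qed.

Definition flip (s : seq V) i := rev (take i s) ++ drop i s.

Lemma size_flip s i : size (flip s i) = size s.
Proof. by rewrite size_cat size_rev -size_cat cat_take_drop. Qed.

Lemma nth_flip x0 s i n : i <= size s ->
  nth x0 (flip s i) n = nth x0 s (if n < i then i.-1 - n else n).
Proof.
move=> is_; rewrite nth_cat size_rev size_takel //; case: ltnP => ni.
  rewrite nth_rev ?size_takel // nth_take; last by move: ni; clear; lia.
  by congr nth; move: ni; clear; lia.
by rewrite nth_drop subnKC.
Qed.

Lemma perm_flip s i : perm_eq (flip s i) s.
Proof. by rewrite -[X in perm_eq _ X](cat_take_drop i s) perm_cat2r perm_rev. Qed.

Lemma flip_sorted x0 s i : sorted g s -> 0 < i < size s ->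
  g (nth x0 s 0) (nth x0 s i) -> sorted g (flip s i).
Proof.
move=> ss /andP[i0 is_] g0i; apply/(sortedP x0) => n; rewrite size_flip => ns.
have step := sortedP x0 ss.
rewrite !nth_flip ?(ltnW is_) //.
have [ni|ni] := ltnP n.+1 i.
  rewrite (ltnW ni) gs.
  have -> : i.-1 - n = (i.-1 - n.+1).+1 by move: ni; clear; lia.
  by apply: step; move: ni is_; clear; lia.
have [ni'|ni'] := ltnP n i; last exact: step.
have -> : i.-1 - n = 0 by move: ni; clear; lia.
by have -> : n.+1 = i by move: ni ni'; clear; lia.
Qed.

(* Let [0], [i] and [j] be the positions of the first vertex of a longest path
   and of two of its neighbours, [1 < i < j], with [j] minimal among all such
   paths. Reversing the first [i] vertices makes the vertex at [i.-1] the first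
   one, so its neighbours are on the path too; by minimality of [j], one of them
   is at a position [m > i], and the chords from [0] and [i.-1] cross. *)
Lemma min_degree3_minor (A : {set V}) : A != set0 ->
  (forall x y, g x y -> x \in A) -> {in A, forall x, 2 < #|nbr g x|} ->
  has_minor g (@complete_graph 4).
Proof.
move=> /set0Pn[x0 x0A] gA deg3.
have pick3 x a b : x \in A -> exists z, [/\ g x z, z != a & z != b].
  move=> xA; have : exists z, z \in nbr g x :\: [set a; b].
    apply/set0Pn; rewrite -card_gt0; have := deg3 x xA; have := cardsID [set a; b] (nbr g x).
    have : #|nbr g x :&: [set a; b]| <= 2.
      by apply: leq_trans (subset_leq_card (subsetIr _ _)) _; rewrite card_set2_le.
    by clear; lia.
  by move=> [z]; rewrite in_setD in_set2 negb_or inE => /andP[/andP[za zb] gxz]; exists z.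
suff long d s : #|V| - size s < d -> s != [::] -> {subset s <= A} -> uniq s -> sorted g s ->
    has_minor g (@complete_graph 4).
  apply: (long _ [:: x0] (ltnSn _)) => //.
  by move=> z; rewrite inE => /eqP->.
elim: d s => // d IHd s ltd s0 sA us ss.
have extend s' z : size s' = size s -> {subset s' <= A} -> uniq s' -> sorted g s' ->
    g (nth x0 s' 0) z -> z \in s' \/ has_minor g (@complete_graph 4).
  case: s' => [|h t] eqs s'A us' ss' ghz.
    by move: s0; rewrite -size_eq0 -eqs.
  have [|zs] := boolP (z \in h :: t); [by left|right].
  have uz : uniq [:: z, h & t] by rewrite cons_uniq zs.
  apply: (IHd [:: z, h & t]) => //.
  - have := max_card [in [:: z, h & t]]; rewrite (card_uniqP uz) [size _]/= -[(size t).+1]/(size (h :: t)).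
    by rewrite eqs; move: ltd; clear; lia.
  - by move=> w; rewrite inE => /orP[/eqP->|/s'A//]; apply: (gA _ h); rewrite gs.
  - by rewrite /= gs ghz.
have chords j s' i : size s' = size s -> {subset s' <= A} -> uniq s' -> sorted g s' ->
    1 < i -> i < j < size s' -> g (nth x0 s' 0) (nth x0 s' i) -> g (nth x0 s' 0) (nth x0 s' j) ->
    has_minor g (@complete_graph 4).
  have [n] := ubnP j; elim: n j s' i => // n IHn j s' i ltj eqs s'A us' ss' i1 /andP[ij js] g0i g0j.
  have is_ := ltn_trans ij js.
  have i1s : i.-1 < size s' := leq_ltn_trans (leq_pred i) is_.
  have [z [gz za zb]] := pick3 (nth x0 s' i.-1) (nth x0 s' i.-2) (nth x0 s' i) (s'A _ (mem_nth x0 i1s)).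
  have i0s : 0 < i < size s' by rewrite is_ ltnW.
  have fs := flip_sorted (x0 := x0) ss' i0s g0i.
  have fn k := nth_flip x0 k (ltnW is_).
  have fA : {subset flip s' i <= A} by move=> w; rewrite (perm_mem (perm_flip s' i)); apply: s'A.
  have fu : uniq (flip s' i) by rewrite (perm_uniq (perm_flip s' i)).
  have f0 : nth x0 (flip s' i) 0 = nth x0 s' i.-1 by rewrite fn ltnW // subn0.
  have gz' : g (nth x0 (flip s' i) 0) z by rewrite f0.
  case: (extend _ z _ fA fu fs gz') => //; first by rewrite size_flip.
  rewrite (perm_mem (perm_flip s' i)) => zs.
  pose m := index z s'; have ms : m < size s' by rewrite index_mem.
  have zE : z = nth x0 s' m by rewrite nth_index.
  rewrite zE in gz za zb gz'.
  have mi : m != i by apply: contraNneq zb => ->.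
  have mi2 : m != i.-2 by apply: contraNneq za => ->.
  have mi1 : m != i.-1 by apply: contraTneq gz => ->; rewrite gi.
  have [im|mi'] := ltnP i m.
    by apply: (@crossing_chords_minor s' x0 i j m) => //; rewrite ?ij ?im.
  apply: (IHn i (flip s' i) (i.-1 - m)) => //.
  - exact: leq_trans ij ltj.
  - by rewrite size_flip.
  - by move: mi mi1 mi2 mi' i1; clear; lia.
  - by rewrite size_flip is_ andbT; move: i1; clear; lia.
  - rewrite f0 fn ifT; last by move: i1; clear; lia.
    have -> : i.-1 - (i.-1 - m) = m by move: mi mi'; clear; lia.
    exact: gz.
  by rewrite f0 fn ltnn gs; have := sortedP x0 ss' i.-1; rewrite prednK ?(ltnW i1) // gs; apply.
have x1 : 0 < size s by rewrite lt0n size_eq0.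
have hA : nth x0 s 0 \in A by apply: sA; apply: mem_nth.
have [z1 [g1 z1s _]] := pick3 (nth x0 s 0) (nth x0 s 1) (nth x0 s 1) hA.
have [z2 [g2 z2s z21]] := pick3 (nth x0 s 0) (nth x0 s 1) z1 hA.
have [z1in|//] := extend s z1 erefl sA us ss g1.
have [z2in|//] := extend s z2 erefl sA us ss g2.
have big z : z \in s -> g (nth x0 s 0) z -> z != nth x0 s 1 -> 1 < index z s.
  move=> zs gz z1'; rewrite ltn_neqAle; apply/andP; split.
    by apply: contraNneq z1' => ->; rewrite nth_index.
  rewrite lt0n; apply: contraTneq gz => z0.
  by rewrite -[z](nth_index x0 zs) z0 gi.
have ind z : z \in s -> index z s < size s by rewrite index_mem.
have : index z1 s != index z2 s.
  by apply: contraNneq z21 => E; rewrite -(nth_index x0 z1in) E nth_index.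
rewrite neq_ltn => /orP[lt12|lt21].
  by apply: (chords (index z2 s) s (index z1 s)) => //; rewrite ?nth_index ?lt12 ?ind ?big.
by apply: (chords (index z1 s) s (index z2 s)) => //; rewrite ?nth_index ?lt21 ?ind ?big.
Qed.

End CompleteMinor.

(** * Elimination orderings of K4-minor-free graphs *)

Definition eliminate (V : finType) (A : {set V}) (g : rel V) (y : V) : rel V := fun a b =>
  restrict (A :\ y) g a b || [&& a != b, a \in nbr g y & b \in nbr g y].

Lemma branch_set_edge (V : finType) (g : rel V) (B : 'I_4 -> {set V}) u y :
  minor_model g (@complete_graph 4) B -> y \in B u -> exists z, g y z.
Proof.
move=> [Bc _ Be] yB.
have [v uv] : exists v, @complete_graph 4 u v.
  have [->|u0] := eqVneq u ord0; last by exists ord0.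
  by exists (Ordinal (isT : 1 < 4)).
have [x [z [xB _ gxz]]] := Be u v uv.
have [_ /(_ y x yB xB) /connectP[p pp xE]] := Bc u.
case: p pp xE => [_ /= xE|w p /= /andP[/and3P[_ _ gyw] _] _]; last by exists w.
by exists z; rewrite -xE.
Qed.

Lemma eliminate_minor (V : finType) (A : {set V}) (g : rel V) (y : V) :
  simple_graph g -> #|nbr g y| <= 2 ->
  has_minor (eliminate A g y) (@complete_graph 4) -> has_minor g (@complete_graph 4).
Proof.
move=> [gs gi] Ny2 [B mB].
have yB u : y \notin B u.
  apply/negP => /(branch_set_edge mB)[z]; rewrite /eliminate /restrict !inE eqxx /=.
  by rewrite gi andbF.
have [N0|[p py]] := set_0Vmem (nbr g y).
  have sub : subrel (eliminate A g y) g.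
    by move=> a b; rewrite /eliminate N0 inE andbF orbF => /and3P[].
  have [Bc Bd Be] := mB; exists B; split=> // [u|u v uv].
    have [B0 Bcon] := Bc u; split=> // a b aB bB.
    apply: connect_sub (Bcon a b aB bB) => c d /and3P[cB dB gcd].
    by apply: connect1; rewrite /induced_edge cB dB sub.
  by have [a [b [aB bB gab]]] := Be u v uv; exists a, b; rewrite sub.
have gyp : g y p by move: py; rewrite inE.
have edge a b : eliminate A g y a b -> g a b \/
    [/\ g y a, g y b & (a == p) || (b == p)].
  move=> /orP[/and3P[_ _]|/and3P[ab]]; [by left|rewrite !inE => ya yb; right; split=> //].
  apply: contraTT Ny2; rewrite negb_or => /andP[ap bp]; rewrite -ltnNge.
  apply: (@leq_trans #|p |: [set a; b]|).
    by rewrite cardsU1 cards2 ab in_set2 negb_or ![p == _]eq_sym ap bp.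
  by apply/subset_leq_card/subsetP => w; rewrite !inE => /or3P[]/eqP->.
have [Bc Bd Be] := mB.
pose C u := if p \in B u then y |: B u else B u.
have BC u : B u \subset C u by rewrite /C; case: ifP => // _; apply: subsetUr.
have yC u : p \in B u -> y \in C u by rewrite /C => ->; rewrite !inE eqxx.
have inC u a : a \in C u -> a \in B u \/ (a = y /\ p \in B u).
  by rewrite /C; case: ifP => [pB|_ ->]; [rewrite in_setU1 => /orP[/eqP->|->]; auto|left].
exists C; split.
- move=> u; have [B0 Bcon] := Bc u; split.
    by apply: contra B0 => /eqP C0; rewrite -subset0 -C0.
  have sym : connect_sym (induced_edge g (C u)).
    by apply: sym_connect_sym => a b; rewrite /induced_edge gs; case: (a \in _); case: (b \in _).
  have BB a b : a \in B u -> b \in B u -> connect (induced_edge g (C u)) a b.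
    move=> aB bB; apply: connect_sub (Bcon a b aB bB) => c d /and3P[cB dB].
    have cC := subsetP (BC u) c cB; have dC := subsetP (BC u) d dB.
    case/edge => [gcd|[yc yd pcd]]; first by apply: connect1; rewrite /induced_edge cC dC.
    have yCu : y \in C u by apply: yC; case/orP: pcd => /eqP <-.
    apply: (@connect_trans _ _ y); apply: connect1; rewrite /induced_edge yCu.
      by rewrite cC gs.
    by rewrite dC.
  have yp : p \in B u -> connect (induced_edge g (C u)) y p.
    by move=> pB; apply: connect1; rewrite /induced_edge yC // (subsetP (BC u)).
  have toB a : a \in C u -> exists2 b, b \in B u & connect (induced_edge g (C u)) a b.
    by case/inC => [aB|[-> pB]]; [exists a|exists p => //; apply: yp].
  move=> a b /toB[a' a'B aa'] /toB[b' b'B bb'].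
  apply: connect_trans aa' (connect_trans (BB a' b' a'B b'B) _).
  by rewrite sym.
- move=> u v uv; have dB := Bd u v uv; rewrite -setI_eq0; apply/eqP/setP => a; rewrite !inE.
  apply/negP => /andP[/inC au /inC av].
  case: au av => [aB|[-> pB]] [aB'|[E pB']].
  + by rewrite (disjointFr dB aB) in aB'.
  + by move: (yB u); rewrite -E aB.
  + by move: (yB v); rewrite aB'.
  + by rewrite (disjointFr dB pB) in pB'.
move=> u v uv; have [a [b [aB bB /edge]]] := Be u v uv.
case=> [gab|[ya yb /orP[]/eqP E]].
- by exists a, b; rewrite !(subsetP (BC _)).
- by exists y, b; rewrite yC ?(subsetP (BC v)) // -E.
- exists a, y; split; [exact: (subsetP (BC u))|by apply: yC; rewrite -E|by rewrite gs].
Qed.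

Lemma K4_free_elimination (V : finType) (A : {set V}) (g : rel V) :
  simple_graph g -> (forall x y, g x y -> x \in A) ->
  ~ has_minor g (@complete_graph 4) ->
  exists T rk, subrel g T /\ elimination T rk.
Proof.
have [n] := ubnP #|A|; elim: n A g => // n IH A g ltA gP gA noK4.
have [gs gi] := gP.
have [A0|A0] := eqVneq A set0.
  exists (fun _ _ => false), (fun x => enum_rank x : nat); split.
    by move=> x y /gA; rewrite A0 inE.
  have U0 x : upper (fun _ _ => false) (fun x : V => enum_rank x : nat) x = set0.
    by apply/setP => z; rewrite !inE.
  split=> // [x y /ord_inj/enum_rank_inj//|x|x y z].
    by rewrite U0 cards0.
  by rewrite U0 inE.
have [y yA Ny2] : exists2 y, y \in A & #|nbr g y| <= 2.
  have [/existsP[y /andP[yA h]]|none] := boolP [exists y, (y \in A) && (#|nbr g y| <= 2)].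
    by exists y.
  case: noK4; apply: (min_degree3_minor gs gi A0 gA) => x xA.
  by rewrite ltnNge; apply: contra none => h; apply/existsP; exists x; rewrite xA.
have Nyy : y \notin nbr g y by rewrite inE gi.
have NA : nbr g y \subset A :\ y.
  apply/subsetP => z zN; rewrite in_setD1 (_ : z != y) /=; last by apply: contraTneq zN => ->.
  by move: zN; rewrite inE gs => /gA.
have [||||T' [rk' [gT' [T's rk'_inj up2 upT]]]] := IH (A :\ y) (eliminate A g y).
- by move: ltA; rewrite (cardsD1 y A) yA.
- split=> [a b|a].
    rewrite /eliminate /restrict gs [b == a]eq_sym [(b \in nbr g y) && _]andbC.
    by case: (a \in A :\ y); case: (b \in A :\ y).
  by rewrite /eliminate /restrict gi eqxx !andbF.
- by move=> a b /orP[/and3P[]//|/and3P[_ aN _]]; apply: (subsetP NA).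
- by move=> h; apply: noK4; apply: eliminate_minor h.
pose T a b := [|| restrict (A :\ y) T' a b, (a == y) && (b \in nbr g y) | (b == y) && (a \in nbr g y)].
pose rk z := if z == y then 0 else (rk' z).+1.
have upy : upper T rk y \subset nbr g y.
  apply/subsetP => z; rewrite inE => /andP[/or3P[/and3P[]|/andP[]//|/andP[/eqP->]]].
    by rewrite in_setD1 eqxx.
  by [].
have upz x : x != y -> upper T rk x \subset upper T' rk' x :\ y.
  move=> xy; apply/subsetP => z; rewrite inE in_setD1 inE /rk (negPf xy).
  case: (eqVneq z y) => [->|zy]; first by rewrite ltn0 andbF.
  by rewrite ltnS /T (negPf xy) (negPf zy) !orbF /= => /andP[/and3P[_ _ ->] ->].
exists T, rk; split.
  move=> a b gab; rewrite /T; have [aE|ay] := eqVneq a y.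
    by rewrite inE -aE gab orbT.
  have [bE|bY] := eqVneq b y.
    by have gya : g y a; [rewrite -bE gs|rewrite [a \in _]inE gya !orbT].
  apply/orP; left; apply/and3P; split; rewrite ?in_setD1 ?ay ?bY ?(gA a b) //.
    by apply: (gA b a); rewrite gs.
  apply: gT'; apply/orP; left; apply/and3P; split=> //; rewrite in_setD1 ?ay ?bY ?(gA a b) //.
  by apply: (gA b a); rewrite gs.
split.
- move=> a b; rewrite /T (_ : restrict (A :\ y) T' a b = restrict (A :\ y) T' b a).
    by congr (_ || _); rewrite orbC.
  by rewrite /restrict T's; case: (a \in _); case: (b \in _).
- move=> a b; rewrite /rk; case: eqP => [->|_]; case: eqP => [->|_] // [] /rk'_inj //.
- move=> x; have [->|xy] := eqVneq x y.
    by apply: leq_trans Ny2; apply: subset_leq_card.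
  apply: leq_trans (up2 x); apply: subset_leq_card; apply: subset_trans (upz x xy) (subsetDl _ _).
move=> x a b aU bU ab.
have [xE|xy] := eqVneq x y.
  rewrite xE in aU bU; have aN := subsetP upy a aU; have bN := subsetP upy b bU.
  apply/orP; left; apply/and3P; split; do ?exact: (subsetP NA).
  by apply: gT'; apply/orP; right; rewrite ab aN bN.
have upA c : c \in upper T rk x -> c \in A :\ y.
  rewrite inE /T (negPf xy) => /andP[/or3P[/and3P[//]|//|/andP[/eqP-> _]]].
  by rewrite /rk eqxx ltn0.
apply/orP; left; apply/and3P; split; do ?exact: upA.
have := subsetP (upz x xy) a aU; have := subsetP (upz x xy) b bU.
by rewrite !in_setD1 => /andP[_ bU'] /andP[_ aU']; apply: (upT x).
Qed.

Theorem theorem1p4 (V : finType) (e : rel V) (He : simple_graph e)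
    (HK4 : ~ has_minor e (@complete_graph 4)) (k : nat) (Hk : 0 < k)
    (HDelta : max_degree e + 3 <= 2 * k) :
  exists alpha : V -> 'I_k, equitable_coloring e alpha.
Proof.
have eA x y : e x y -> x \in [set: V] by rewrite inE.
have [T [rk [eT Tel]]] := K4_free_elimination He eA HK4.
have dege : max_deg_le e (2 * k - 3).
  move=> x; apply: (@leq_trans (max_degree e)); first exact: (@leq_bigmax _ (degree e) x).
  by move: HDelta; clear; lia.
have k1 : 1 < k by move: HDelta; clear; lia.
have [alpha [aP aE]] := partial_2tree_equitable k1 (And4 He eA eT Tel) dege.
exists alpha; split=> // i j.
have cls c : [set x in [set: V] | alpha x == c] = color_class alpha c.
  by apply/setP => x; rewrite !inE.
by rewrite -!cls.
Qed.
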